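(* Let $\gamma\in(0,1)$, $\beta>1$, $\mu,\epsilon>0$, $\mu_2$ sufficiently large, and let $(\xi,\nu)=(\xi_{c,\mu_2},\nu_{c,\mu_2})\in H^1(\mathbb R)\times H^1(\mathbb R)$, $|c|$ small, be the even solution of $$-c\,\mathcal W\xi+\mathcal Z\nu=\tfrac{\epsilon}{\gamma}\xi\nu,\qquad \xi=\tfrac{1}{1-\gamma}\Big(c\nu+\tfrac{\epsilon}{2\gamma}\nu^2\Big)$$ lying on the smooth branch in $c$ emanating from the $c=0$ solution $(\xi_{0,\mu_2},\nu_{0,\mu_2})$. Then there exist constants $\eta_1>0$ and $N_1>0$ such that $e^{\eta_1|x|}|\xi(x)|\le N_1$ and $e^{\eta_1|x|}|\nu(x)|\le N_1$ for all $x\in\mathbb R$.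
   Context: $|D|$ is the Fourier multiplier with symbol $|k|$. For $\mu_2>0$: $\mathcal W=1+\frac\beta\gamma\sqrt\mu|D|\coth(\sqrt{\mu_2}|D|)$ and $\mathcal Z=\frac1\gamma\big(1+\frac{\beta-1}{\gamma}\sqrt\mu|D|\coth(\sqrt{\mu_2}|D|)\big)$ (symbols extended by continuity at $k=0$). The $c=0$ solution $(\xi_{0,\mu_2},\nu_{0,\mu_2})$ is the even solution of $\mathcal Z\nu=\frac\epsilon\gamma\xi\nu$, $\xi=\frac{\epsilon}{2\gamma(1-\gamma)}\nu^2$ which, as $\mu_2\to\infty$, converges to $(\xi_0,\nu_0)$, with $\nu_0$ the even positive solution of $\frac{(\beta-1)\sqrt\mu}{\gamma^2}|D|\nu_0+\frac1\gamma\nu_0-\frac{\epsilon^2}{2\gamma^2(1-\gamma)}\nu_0^3=0$ and $\xi_0=\frac{\epsilon}{2\gamma(1-\gamma)}\nu_0^2$. *)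

(* Defs.v *)
From mathcomp Require Import all_boot all_order all_algebra.
From mathcomp Require Import all_classical all_reals all_analysis.
Set Implicit Arguments. Unset Strict Implicit. Unset Printing Implicit Defensive.
Import Order.TTheory GRing.Theory Num.Theory numFieldNormedType.Exports.
Local Open Scope classical_set_scope.
Local Open Scope ring_scope.

Definition Lint {R : realType} (f : R -> R) : R :=
  Rintegral (@lebesgue_measure R) setT f.

Definition L2 {R : realType} (f : R -> R) : Prop :=
  measurable_fun setT f /\
  (@lebesgue_measure R).-integrable setT (fun x => (f x ^+ 2)%:E).

Definition test_fun {R : realType} (phi : R -> R) : Prop :=
  (exists D : nat -> R -> R, D 0%N = phi /\
      forall (n : nat) (x : R), is_derive x 1 (D n) (D n.+1 x)) /\
  (exists K : R, forall x : R, K < `|x| -> phi x = 0).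

Definition is_wderiv {R : realType} (f g : R -> R) : Prop :=
  L2 f /\ L2 g /\
  forall phi : R -> R, test_fun phi ->
    Lint (fun x => f x * derive1 phi x) = - Lint (fun x => g x * phi x).

Definition H1 {R : realType} (f : R -> R) : Prop := exists g, is_wderiv f g.

Definition H1small {R : realType} (f : R -> R) (e : R) : Prop :=
  exists g, is_wderiv f g /\
    Lint (fun x => f x ^+ 2) + Lint (fun x => g x ^+ 2) < e.

Definition H1conv {R : realType} (F : R -> R -> R) (f : R -> R) : Prop :=
  forall e : R, 0 < e -> exists T : R, forall t : R, T < t ->
    H1small (fun x => F t x - f x) e.

Definition smooth_H1 {R : realType} (c0 : R) (B : R -> R -> R) : Prop :=
  exists D : nat -> R -> R -> R,
    (forall c, `|c| < c0 -> D 0%N c = B c) /\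
    forall (n : nat) (c : R), `|c| < c0 ->
      forall e : R, 0 < e -> exists2 d : R, 0 < d &
        forall h : R, 0 < `|h| < d -> `|c + h| < c0 ->
          H1small (fun x => (D n (c + h) x - D n c x) / h - D n.+1 c x) e.

(* Fourier multiplier with real even symbol m acting on a test function:
   F^{-1}(m Fphi)(x) = (1/2pi) int m(k) int phi(y) cos(k(x-y)) dy dk *)
Definition fmult {R : realType} (m : R -> R) (phi : R -> R) (x : R) : R :=
  (2 * pi)^-1 * Lint (fun k => m k * Lint (fun y => phi y * cos (k * (x - y)))).

Definition coth {R : realType} (a : R) : R :=
  (expR a + expR (- a)) / (expR a - expR (- a)).

(* symbol |k| coth(sqrt mu2 |k|), extended by continuity (1/sqrt mu2) at 0 *)
Definition symD {R : realType} (mu2 k : R) : R :=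
  if k == 0 then (Num.sqrt mu2)^-1 else `|k| * coth (Num.sqrt mu2 * `|k|).

Definition Wsym {R : realType} (gamma beta mu mu2 : R) (k : R) : R :=
  1 + beta / gamma * Num.sqrt mu * symD mu2 k.

Definition Zsym {R : realType} (gamma beta mu mu2 : R) (k : R) : R :=
  gamma^-1 * (1 + (beta - 1) / gamma * Num.sqrt mu * symD mu2 k).

Definition even_fun {R : realType} (f : R -> R) : Prop := forall x, f (- x) = f x.

(* (xi, nu) is an even H^1 solution of
     -c W xi + Z nu = (eps/gamma) xi nu,  xi = (c nu + eps/(2 gamma) nu^2)/(1-gamma)
   (first equation in the weak/distributional sense; nu continuous representative) *)
Definition IsSol {R : realType} (gamma beta mu eps mu2 c : R) (xi nu : R -> R) : Prop :=
  H1 xi /\ H1 nu /\ even_fun xi /\ even_fun nu /\ continuous nu /\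
  (forall x, xi x = (1 - gamma)^-1 * (c * nu x + eps / (2 * gamma) * nu x ^+ 2)) /\
  forall phi : R -> R, test_fun phi ->
    - c * Lint (fun x => xi x * fmult (Wsym gamma beta mu mu2) phi x)
    + Lint (fun x => nu x * fmult (Zsym gamma beta mu mu2) phi x)
    = eps / gamma * Lint (fun x => xi x * nu x * phi x).

Definition IsLimSol {R : realType} (gamma beta mu eps : R) (xi0 nu0 : R -> R) : Prop :=
  H1 nu0 /\ even_fun nu0 /\ continuous nu0 /\ (forall x, 0 < nu0 x) /\
  (forall x, xi0 x = eps / (2 * gamma * (1 - gamma)) * nu0 x ^+ 2) /\
  forall phi : R -> R, test_fun phi ->
    (beta - 1) * Num.sqrt mu / gamma ^+ 2 * Lint (fun x => nu0 x * fmult (fun k => `|k|) phi x)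
    + gamma^-1 * Lint (fun x => nu0 x * phi x)
    - eps ^+ 2 / (2 * gamma ^+ 2 * (1 - gamma)) * Lint (fun x => nu0 x ^+ 3 * phi x) = 0.

(* Main.v *)
Require Import Defs.
From mathcomp Require Import all_boot all_order all_algebra.
From mathcomp Require Import all_classical all_reals all_analysis.
From mathcomp Require Import measurable_realfun ring lra.
Set Implicit Arguments. Unset Strict Implicit. Unset Printing Implicit Defensive.
Import Order.TTheory GRing.Theory Num.Theory numFieldNormedType.Exports.
Local Open Scope classical_set_scope.
Local Open Scope ring_scope.

(* Write [a = sqrt mu2] and [s_j = (j + 1) pi / a].  The partial fraction expansion
     [|k| coth (a |k|) = 1/a + (2/a) sum_j k^2 / (s_j^2 + k^2)]
   exhibits [|D| coth (a |D|)] as [1/a] plus a sum of operators [1 - R_j], where [R_j] is the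
   convolution with the probability density [(s_j/2) e^(- s_j |x|)].  Such an operator obeys the
   maximum principle, and it preserves exponentials of small rate up to a small error.
   After eliminating [xi], the equation reads [|D| coth (a |D|) w = f] with
   [w = nu (B - q nu)] and [f = - nu (A + O(nu))], where [A, B > 0] for small [c].  Since [nu]
   is in [H^1], it vanishes at infinity, so [f] and [w] have opposite signs far out; comparing
   [w] and [- w] with [C e^(- eta |x|)] gives the exponential decay of [w], hence of [nu] and
   [xi]. *)

(** * Integrals over the real line *)

(** The equation is available only when tested against smooth compactly supported functions, where
    [fmult] converges by the decay of their Fourier transforms. Everything about the multiplier is
    therefore proved on test functions: each finite partial sum is an explicit combination of
    convolutions, and dominated convergence, in k and then in x, reaches the full symbol. Since [w]
    is merely continuous, the equation is tested with a bump centred at a maximum of a mollified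
    comparison function, and the resolvents are moved from the bump onto the mollification of [w].
    The rate eta = s_0 / 4 comes from a balance. Against the barrier h = C e^(- eta |x|), the
    operator 1 - R_j loses at most 2 eta^2 h / s_j^2, and the s_j^(-2) sum to at most 2 / s_0^2, so
    the total loss is at most h/4. Multiplied by 2/a it is h/(2a), less than the h/a supplied by the
    constant term 1/a. That term, the value of the symbol at k = 0, makes the comparison strict. *)

Definition integr {R : realType} (f : R -> R) : Prop :=
  (@lebesgue_measure R).-integrable setT (EFin \o f).

Lemma integr_meas {R : realType} (f : R -> R) : integr f -> measurable_fun setT f.
Proof. by move=> /integrableP[/measurable_EFinP]. Qed.

Lemma continuous_meas {R : realType} (f : R -> R) : continuous f -> measurable_fun setT f.
Proof. exact: continuous_measurable_fun. Qed.

Lemma integr_le {R : realType} (f g : R -> R) : measurable_fun setT f ->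
  (forall x, `|f x| <= g x) -> integr g -> integr f.
Proof.
move=> mf fg; apply: le_integrable => //; first exact/measurable_EFinP.
by move=> x _ /=; rewrite lee_fin (le_trans (fg x))// ler_norm.
Qed.

Lemma integrZ {R : realType} (k : R) (f : R -> R) :
  integr f -> integr (fun x => k * f x).
Proof. by move=> /(@integrableZl _ _ _ _ _ measurableT k). Qed.

Lemma integrD {R : realType} (f g : R -> R) :
  integr f -> integr g -> integr (fun x => f x + g x).
Proof. by move=> F G; have := integrableD measurableT F G. Qed.

Lemma integrB {R : realType} (f g : R -> R) :
  integr f -> integr g -> integr (fun x => f x - g x).
Proof. by move=> F G; have := integrableB measurableT F G. Qed.

Lemma integr_norm {R : realType} (f : R -> R) : integr f -> integr (fun x => `|f x|).
Proof. by move=> F; have := integrable_norm F. Qed.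

Lemma LintE {R : realType} (f : R -> R) : integr f ->
  (\int[@lebesgue_measure R]_x (f x)%:E = (Lint f)%:E)%E.
Proof. by move=> F; rewrite /Lint /Rintegral fineK //; exact: integrable_fin_num. Qed.

Lemma eq_Lint {R : realType} (f g : R -> R) : f =1 g -> Lint f = Lint g.
Proof. by move=> /funext ->. Qed.

Lemma LintZ {R : realType} (k : R) (f : R -> R) :
  integr f -> Lint (fun x => k * f x) = k * Lint f.
Proof. by move=> F; rewrite /Lint RintegralZl. Qed.

Lemma LintD {R : realType} (f g : R -> R) : integr f -> integr g ->
  Lint (fun x => f x + g x) = Lint f + Lint g.
Proof. by move=> F G; rewrite /Lint RintegralD. Qed.

Lemma LintB {R : realType} (f g : R -> R) : integr f -> integr g ->
  Lint (fun x => f x - g x) = Lint f - Lint g.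
Proof. by move=> F G; rewrite /Lint RintegralB. Qed.

Lemma Lint_le {R : realType} (f g : R -> R) : integr f -> integr g ->
  (forall x, f x <= g x) -> Lint f <= Lint g.
Proof. by move=> F G fg; apply: le_Rintegral. Qed.

Lemma Lint_ge0 {R : realType} (f : R -> R) : (forall x, 0 <= f x) -> 0 <= Lint f.
Proof. by move=> f0; apply: Rintegral_ge0 => x _. Qed.

Lemma Lint_norm {R : realType} (f : R -> R) : integr f -> `|Lint f| <= Lint (fun x => `|f x|).
Proof. by move=> F; apply: le_normr_Rintegral. Qed.

Lemma Lint_norm_le {R : realType} (f g : R -> R) : integr f -> integr g ->
  (forall x, `|f x| <= g x) -> `|Lint f| <= Lint g.
Proof.
move=> F G fg; apply: (le_trans (Lint_norm F)).
by apply: Lint_le => //; exact: integr_norm.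
Qed.

Lemma Lint_dct {R : realType} (F : nat -> R -> R) (f g : R -> R) :
  (forall n, measurable_fun setT (F n)) -> integr g ->
  (forall n x, `|F n x| <= g x) ->
  (forall x, F n x @[n --> \oo] --> f x) ->
  integr f /\ Lint (F n) @[n --> \oo] --> Lint f.
Proof.
move=> mF G Fg Ff.
have [] := @dominated_convergence _ _ R (@lebesgue_measure R) setT measurableT
  (fun n => EFin \o F n) (EFin \o f) (EFin \o g).
- by move=> n; apply/measurable_EFinP; exact: mF.
- apply/measurable_EFinP; apply: (@measurable_fun_cvg _ _ _ _ F) => //.
- by apply: aeW => x _; apply/fine_cvgP; split; [exact: nearW|exact: Ff].
- exact: G.
- by apply: aeW => x n _ /=; rewrite lee_fin.
move=> intf _ cv; split=> //.
have e : (\int[@lebesgue_measure R]_x (EFin \o f) x)%E = (Lint f)%:E by exact: LintE.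
by rewrite e in cv; exact: fine_cvg cv.
Qed.

(** This function is the common majorant below: exponentials, resolvent symbols and transforms of
    test functions are all compared with it. *)
Lemma integr_oneDsqrV {R : realType} : integr (fun x : R => (1 + x ^+ 2)^-1).
Proof.
have c := @continuous_oneDsqrV R.
apply/integrableP; split.
  by apply/measurable_EFinP; exact: continuous_meas c.
have p (x : R) : 0 <= (1 + x ^+ 2)^-1 by rewrite invr_ge0 addr_ge0 // sqr_ge0.
under eq_integral => x _ do rewrite /= ger0_norm //.
rewrite (@ge0_symfun_integralT _ (fun x : R => (1 + x ^+ 2)^-1)) //.
  rewrite -set_itvcy (_ : (\int[_]_(x in _) _)%E = (pi / 2)%:E) ?ltry //.
  by rewrite -integral0y_oneDsqr.
by move=> x /=; rewrite sqrrN.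
Qed.

(** Dominated convergence with majorant |f|; it reduces integrals over the line to the fundamental
    theorem of calculus on segments. *)
Lemma Lint_trunc {R : realType} (f : R -> R) (x0 : R) : integr f ->
  Rintegral (@lebesgue_measure R) `[x0 - n%:R, x0 + n%:R] f @[n --> \oo] --> Lint f.
Proof.
move=> F.
under eq_fun do rewrite Rintegral_mkcond.
have [] // := @Lint_dct _ (fun n => f \_ `[x0 - n%:R, x0 + n%:R]) f (fun x => `|f x|).
- move=> n; apply/(measurable_restrictT _ _).1 => //.
  by apply: measurable_funTS; exact: integr_meas.
- exact: integr_norm.
- by move=> n x; rewrite patchE; case: ifP => // _; rewrite normr0.
- move=> x; apply: cvg_near_cst.
  near=> n; rewrite patchE mem_set //= in_itv /=.
  have : `|x - x0| <= n%:R by near: n; apply: nbhs_infty_ger.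
  by rewrite ler_norml; lra.
Unshelve. all: by end_near. Qed.

Lemma is_derive_continuous {R : realType} (f df : R -> R) :
  (forall x : R, is_derive x 1 f (df x)) -> continuous f.
Proof. by move=> D x; exact/differentiable_continuous/derivable1_diffP/(@ex_derive _ _ _ _ _ _ _ (D x)). Qed.

Lemma Rintegral_FTC {R : realType} (f P : R -> R) (a b : R) : a <= b ->
  continuous f ->
  (forall x : R, is_derive x 1 P (f x)) ->
  Rintegral (@lebesgue_measure R) `[a, b] f = P b - P a.
Proof.
move=> ab cf dP; have cP := is_derive_continuous dP.
move: ab; rewrite le_eqVlt => /predU1P[->|ab].
  by rewrite set_itv1 Rintegral_set1 subrr.
rewrite /Rintegral (@continuous_FTC2 _ f P) //.
- exact: continuous_subspaceT.
- split.
  + by move=> x _; exact: (@ex_derive _ _ _ _ _ _ _ (dP x)).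
  + by apply: cvg_at_right_filter; exact: cP.
  + by apply: cvg_at_left_filter; exact: cP.
- by move=> x _; rewrite derive1E (@derive_val _ _ _ _ _ _ _ (dP x)).
Qed.

Lemma cvg_pinfty_shift {R : realType} (P : R -> R) (a L : R) : P x @[x --> +oo] --> L ->
  P (a + n%:R) @[n --> \oo] --> L.
Proof.
move=> h; apply: cvg_comp h.
apply/cvgryPge => A; near=> n.
have : A - a <= n%:R by near: n; apply: nbhs_infty_ger.
by lra.
Unshelve. all: by end_near. Qed.

Lemma cvg_ninfty_shift {R : realType} (P : R -> R) (a L : R) : P x @[x --> -oo] --> L ->
  P (a - n%:R) @[n --> \oo] --> L.
Proof.
move=> h; apply: cvg_comp h.
apply/cvgrNyPle => A; near=> n.
have : a - A <= n%:R by near: n; apply: nbhs_infty_ger.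
by lra.
Unshelve. all: by end_near. Qed.

(** Meant for integrands containing |x - x0|, whose formula changes at [x0]. Each formula is
    extended to a function [f1], [f2] continuous on the whole line, so that its primitive is
    differentiable everywhere and no one-sided derivative occurs. *)
Lemma Lint_FTC_glue {R : realType} (f f1 f2 P1 P2 : R -> R) (x0 L l : R) :
  integr f -> continuous f1 -> continuous f2 ->
  (forall x, x0 <= x -> f x = f1 x) -> (forall x, x <= x0 -> f x = f2 x) ->
  (forall x : R, is_derive x 1 P1 (f1 x)) -> (forall x : R, is_derive x 1 P2 (f2 x)) ->
  P1 x @[x --> +oo] --> L -> P2 x @[x --> -oo] --> l ->
  Lint f = L - P1 x0 + P2 x0 - l.
Proof.
move=> F c1 c2 e1 e2 d1 d2 cL cl.
apply: (@cvg_unique _ _ _ _ _ _ (Lint_trunc x0 F)) => //.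
rewrite (_ : (fun n => _) = fun n : nat => P1 (x0 + n%:R) - P1 x0 + P2 x0 - P2 (x0 - n%:R)).
  apply: cvgB; last exact: cvg_ninfty_shift.
  apply: cvgD; last exact: cvg_cst.
  apply: cvgB; last exact: cvg_cst.
  exact: cvg_pinfty_shift.
apply/funext => n.
have n0 : 0 <= n%:R :> R by [].
rewrite (@itv_bndbnd_setU _ _ _ (BLeft x0)) ?bnd_simp; [|lra|lra].
have iS (A : set R) : measurable A -> (@lebesgue_measure R).-integrable A (EFin \o f).
  by move=> mA; apply: integrableS F.
rewrite Rintegral_setU //; last 2 first.
- by apply: iS; apply: measurableU.
- apply/disj_setPS => y [/=]; rewrite !in_itv /= => /andP[_ h] /andP[h' _].
  by have := lt_le_trans h h'; rewrite ltxx.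
rewrite Rintegral_itv_bndo_bndc; last exact: iS.
have -> : Rintegral lebesgue_measure `[x0 - n%:R, x0] f = Rintegral lebesgue_measure `[x0 - n%:R, x0] f2.
  by apply: eq_Rintegral => x; rewrite inE /= in_itv /= => /andP[_ h]; exact: e2.
have -> : Rintegral lebesgue_measure `[x0, x0 + n%:R] f = Rintegral lebesgue_measure `[x0, x0 + n%:R] f1.
  by apply: eq_Rintegral => x; rewrite inE /= in_itv /= => /andP[h _]; exact: e1.
rewrite (@Rintegral_FTC _ f2 P2) //; [|lra].
rewrite (@Rintegral_FTC _ f1 P1) //; [|lra].
lra.
Qed.

Lemma Lint_FTC {R : realType} (f P : R -> R) (L l : R) :
  integr f -> continuous f -> (forall x : R, is_derive x 1 P (f x)) ->
  P x @[x --> +oo] --> L -> P x @[x --> -oo] --> l -> Lint f = L - l.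
Proof.
move=> F c d cL cl.
by rewrite (@Lint_FTC_glue _ f f f P P 0 L l) //; lra.
Qed.

(** The product majorant makes integrability on the plane a consequence of two integrals over the
    line, through Tonelli. *)
Lemma Lint_fubini {R : realType} (F : R * R -> R) (p q : R -> R) :
  measurable_fun setT F -> integr p -> integr q ->
  (forall x y, `|F (x, y)| <= p x * q y) ->
  [/\ integr (fun x => Lint (fun y => F (x, y))),
      integr (fun y => Lint (fun x => F (x, y))) &
  Lint (fun x => Lint (fun y => F (x, y))) = Lint (fun y => Lint (fun x => F (x, y)))].
Proof.
move=> mF ip iq bF.
set mu := @lebesgue_measure R.
have mF1 x : measurable_fun setT (fun y => F (x, y)).
  by apply: (measurableT_comp mF); exact: measurable_pair1.
have mF2 y : measurable_fun setT (fun x => F (x, y)).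
  by apply: (measurableT_comp mF); exact: measurable_pair2.
have i1 x : integr (fun y => F (x, y)).
  apply: (integr_le (g := fun y => p x * q y)) => //; exact: integrZ.
have i2 y : integr (fun x => F (x, y)).
  apply: (integr_le (g := fun x => q y * p x)) => //; last exact: integrZ.
  by move=> x; rewrite mulrC.
have iF : (mu \x mu)%E.-integrable setT (EFin \o F).
  apply/integrable12ltyP; first exact/measurable_EFinP.
  apply: (@le_lt_trans _ _ (\int[mu]_x (p x * Lint q)%:E)%E); last first.
    have : integr (fun x => Lint q * p x) by exact: integrZ.
    move=> /LintE h; under eq_integral => x _ do rewrite mulrC.
    by rewrite h ltry.
  apply: ge0_le_integral => //.
  - by move=> x _; apply: integral_ge0.
  - apply: (@measurable_fun_fubini_tonelli_F _ _ _ _ _ mu (fun z => `|(F z)%:E|)%E) => //.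
    by apply: measurableT_comp => //; apply/measurable_EFinP.
  - apply/measurable_EFinP; apply: measurable_funM => //.
    exact: integr_meas.
  - move=> x _; rewrite -LintZ // -LintE; last exact: integrZ.
    apply: ge0_le_integral => //.
    + by apply: measurableT_comp => //; apply/measurable_EFinP; exact: mF1.
    + by apply/measurable_EFinP; apply: integr_meas; exact: integrZ.
    + by move=> y _; rewrite lee_fin.
have e1 x : (\int[mu]_y (F (x, y))%:E = (Lint (fun y => F (x, y)))%:E)%E by exact: LintE.
have e2 y : (\int[mu]_x (F (x, y))%:E = (Lint (fun x => F (x, y)))%:E)%E by exact: LintE.
have I1 : integr (fun x => Lint (fun y => F (x, y))).
  have := integrable_fubini_F iF.
  by apply: eq_integrable => // x _ /=; rewrite -e1.
have I2 : integr (fun y => Lint (fun x => F (x, y))).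
  apply: (integr_le (g := fun y => Lint p * q y)); last exact: integrZ.
  - apply/measurable_EFinP; have := measurable_fubini_G iF.
    by apply: eq_measurable_fun => y _; rewrite /fubini_G /= e2.
  - move=> y; rewrite mulrC -LintZ //.
    by apply: Lint_norm_le => // [|x]; [exact: integrZ|rewrite mulrC].
split; [exact: I1|exact: I2|].
have := Fubini iF.
under eq_integral => x _ do rewrite /= e1.
under [X in _ = X -> _]eq_integral => x _ do rewrite /= e2.
by rewrite (LintE I1) (LintE I2) => -[].
Qed.

(** * Rules and tactics for derivatives and continuity *)

Lemma der_cst {R : realType} (c x : R) : is_derive x 1 (fun _ : R => c) 0.
Proof. exact: is_derive_cst. Qed.
Lemma der_id {R : realType} (x : R) : is_derive x 1 (fun y : R => y) 1.
Proof. exact: is_derive_id. Qed.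
Lemma der_add {R : realType} (f g : R -> R) (x a b : R) : is_derive x 1 f a ->
  is_derive x 1 g b -> is_derive x 1 (fun y => f y + g y) (a + b).
Proof. by move=> A B; exact: is_deriveD. Qed.
Lemma der_opp {R : realType} (f : R -> R) (x a : R) : is_derive x 1 f a ->
  is_derive x 1 (fun y => - f y) (- a).
Proof. by move=> A; exact: is_deriveN. Qed.
Lemma der_mul {R : realType} (f g : R -> R) (x a b : R) : is_derive x 1 f a ->
  is_derive x 1 g b -> is_derive x 1 (fun y => f y * g y) (a * g x + f x * b).
Proof.
move=> A B; apply: (is_derive_eq (is_deriveM A B)).
by rewrite /GRing.scale /=; ring.
Qed.
Lemma der_comp {R : realType} (h f : R -> R) (x a b : R) : is_derive (f x) 1 h b ->
  is_derive x 1 f a -> is_derive x 1 (fun y => h (f y)) (b * a).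
Proof. by move=> A B; exact: (is_derive1_comp A B). Qed.
Lemma der_pow {R : realType} (f : R -> R) (n : nat) (x a : R) : is_derive x 1 f a ->
  is_derive x 1 (fun y => f y ^+ n.+1) (n.+1%:R * f x ^+ n * a).
Proof.
move=> A; elim: n => [|n IH]; first by apply: is_derive_eq A _; rewrite expr0; ring.
rewrite (_ : (fun y => _) = fun y => f y * f y ^+ n.+1).
  by apply: is_derive_eq (der_mul A IH) _; rewrite [n.+2%:R]mulrS exprS; ring.
by apply/funext => y; rewrite exprS.
Qed.
Lemma der_expR {R : realType} (f : R -> R) (x a : R) : is_derive x 1 f a ->
  is_derive x 1 (fun y => expR (f y)) (expR (f x) * a).
Proof. by move=> A; apply: der_comp => //; exact: is_derive_expR. Qed.
Lemma der_cos {R : realType} (f : R -> R) (x a : R) : is_derive x 1 f a ->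
  is_derive x 1 (fun y => cos (f y)) (- sin (f x) * a).
Proof. by move=> A; apply: der_comp => //; exact: is_derive_cos. Qed.
Lemma der_sin {R : realType} (f : R -> R) (x a : R) : is_derive x 1 f a ->
  is_derive x 1 (fun y => sin (f y)) (cos (f x) * a).
Proof. by move=> A; apply: der_comp => //; exact: is_derive_sin. Qed.

(** The derivative is built as an existential variable along the syntax of the function. Subterms
    without a rule remain as goals, and the last goal equates the derivative found with the claimed
    one. *)
Ltac deriv1 := lazymatch goal with
  | |- is_derive _ _ (fun _ => ?c) _ => notypeclasses refine (der_cst _ _)
  | |- is_derive _ _ (fun y => y) _ => notypeclasses refine (der_id _)
  | |- is_derive _ _ (fun y => @?f y + @?g y) _ => notypeclasses refine (der_add (f := f) (g := g) _ _)
  | |- is_derive _ _ (fun y => - @?f y) _ => notypeclasses refine (der_opp (f := f) _)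
  | |- is_derive _ _ (fun y => @?f y * @?g y) _ => notypeclasses refine (der_mul (f := f) (g := g) _ _)
  | |- is_derive _ _ (fun y => @?f y ^+ _) _ => notypeclasses refine (der_pow (f := f) _ _)
  | |- is_derive _ _ (fun y => expR (@?f y)) _ => notypeclasses refine (der_expR (f := f) _)
  | |- is_derive _ _ (fun y => cos (@?f y)) _ => notypeclasses refine (der_cos (f := f) _)
  | |- is_derive _ _ (fun y => sin (@?f y)) _ => notypeclasses refine (der_sin (f := f) _)
  end.
Ltac deriv := eapply is_derive_eq; [repeat deriv1 | cbv beta].

Lemma cont_cst {R : realType} (c : R) : continuous (fun _ : R => c).
Proof. exact: cst_continuous. Qed.
Lemma cont_id {R : realType} : continuous (fun x : R => x).
Proof. by move=> x. Qed.
Lemma cont_add {R : realType} (f g : R -> R) : continuous f -> continuous g ->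
  continuous (fun x => f x + g x).
Proof. by move=> F G x; apply: cvgD; [exact: F|exact: G]. Qed.
Lemma cont_opp {R : realType} (f : R -> R) : continuous f -> continuous (fun x => - f x).
Proof. by move=> F x; apply: cvgN; exact: F. Qed.
Lemma cont_mul {R : realType} (f g : R -> R) : continuous f -> continuous g ->
  continuous (fun x => f x * g x).
Proof. by move=> F G x; apply: cvgM; [exact: F|exact: G]. Qed.
Lemma cont_inv {R : realType} (f : R -> R) : (forall x, f x != 0) -> continuous f ->
  continuous (fun x => (f x)^-1).
Proof. by move=> n F x; apply: cvgV => //; exact: F. Qed.
Lemma cont_comp {R : realType} (h f : R -> R) : continuous h -> continuous f ->
  continuous (fun x => h (f x)).
Proof. by move=> H F x; apply: continuous_comp; [exact: F|exact: H]. Qed.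
Lemma cont_pow {R : realType} (f : R -> R) n : continuous f -> continuous (fun x => f x ^+ n).
Proof.
move=> F; elim: n => [|n IH].
  rewrite (_ : (fun x => _) = fun _ => 1); first exact: cont_cst.
  by apply/funext => x; rewrite expr0.
rewrite (_ : (fun x => _) = fun x => f x * f x ^+ n); first exact: cont_mul.
by apply/funext => x; rewrite exprS.
Qed.
Lemma cont_norm {R : realType} (f : R -> R) : continuous f -> continuous (fun x => `|f x|).
Proof. by move=> F x; apply: cvg_norm; exact: F. Qed.
Lemma cont_expR {R : realType} (f : R -> R) : continuous f -> continuous (fun x => expR (f x)).
Proof. by apply: cont_comp; exact: continuous_expR. Qed.
Lemma cont_cos {R : realType} (f : R -> R) : continuous f -> continuous (fun x => cos (f x)).
Proof. by apply: cont_comp; exact: continuous_cos. Qed.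
Lemma cont_sin {R : realType} (f : R -> R) : continuous f -> continuous (fun x => sin (f x)).
Proof. by apply: cont_comp; exact: continuous_sin. Qed.

Ltac cont1 := lazymatch goal with
  | |- continuous (fun _ => ?c) => apply: cont_cst
  | |- continuous (fun y => y) => apply: cont_id
  | |- continuous (fun y => @?f y + @?g y) => apply: (cont_add (f := f) (g := g))
  | |- continuous (fun y => - @?f y) => apply: (cont_opp (f := f))
  | |- continuous (fun y => @?f y * @?g y) => apply: (cont_mul (f := f) (g := g))
  | |- continuous (fun y => (@?f y)^-1) => apply: (cont_inv (f := f))
  | |- continuous (fun y => @?f y ^+ _) => apply: (cont_pow (f := f))
  | |- continuous (fun y => `|@?f y|) => apply: (cont_norm (f := f))
  | |- continuous (fun y => expR (@?f y)) => apply: (cont_expR (f := f))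
  | |- continuous (fun y => cos (@?f y)) => apply: (cont_cos (f := f))
  | |- continuous (fun y => sin (@?f y)) => apply: (cont_sin (f := f))
  | |- continuous (fun y => ?h (@?f y)) => apply: (cont_comp (h := h) (f := f))
  end.
Ltac cont := repeat (first [assumption | cont1]).

Lemma sqD1_gt0 {R : realType} (x : R) : 0 < 1 + x ^+ 2.
Proof. by rewrite ltr_pwDl // sqr_ge0. Qed.

Lemma integr_decay {R : realType} (f : R -> R) (C : R) : measurable_fun setT f ->
  (forall x, `|f x| <= C * (1 + x ^+ 2)^-1) -> integr f.
Proof.
move=> mf b; apply: (integr_le (g := fun x => C * (1 + x ^+ 2)^-1)) => //.
by apply: integrZ; exact: integr_oneDsqrV.
Qed.

Lemma expR_decay {R : realType} (s x : R) : 0 < s ->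
  expR (- (s * `|x|)) <= (1 + 4 / s ^+ 2) * (1 + x ^+ 2)^-1.
Proof.
move=> s0; set u := s * `|x|.
have u0 : 0 <= u by rewrite mulr_ge0 // ltW.
(* From e^u = (e^(u/2))^2 >= (1 + u/2)^2. *)
have e : 1 + u ^+ 2 / 4 <= expR u.
  have -> : expR u = expR (u / 2) ^+ 2 by rewrite -expRM_natl; congr expR; field.
  have := expR_ge1Dx (u / 2); nra.
have x2 : x ^+ 2 = u ^+ 2 / s ^+ 2.
  by rewrite /u exprMn real_normK ?num_real //; field; rewrite gt_eqF.
rewrite expRN ler_pdivlMr ?sqD1_gt0 // mulrC ler_pdivrMr ?expR_gt0 //.
apply: (@le_trans _ _ ((1 + 4 / s ^+ 2) * (1 + u ^+ 2 / 4))); last first.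
  by rewrite ler_wpM2l // addr_ge0 // divr_ge0 // sqr_ge0.
rewrite x2 -subr_ge0.
have -> : (1 + 4 / s ^+ 2) * (1 + u ^+ 2 / 4) - (1 + u ^+ 2 / s ^+ 2) = 4 / s ^+ 2 + u ^+ 2 / 4.
  by field; rewrite gt_eqF.
by rewrite addr_ge0 // divr_ge0 // sqr_ge0.
Qed.

Lemma integr_exp {R : realType} (s : R) : 0 < s -> integr (fun x => expR (- (s * `|x|))).
Proof.
move=> s0; apply: (@integr_decay _ _ (1 + 4 / s ^+ 2)).
  by apply: continuous_meas; cont.
by move=> x; rewrite ger0_norm ?expR_ge0 //; exact: expR_decay.
Qed.

Lemma Lint_oneDsqrV {R : realType} : Lint (fun x : R => (1 + x ^+ 2)^-1) = pi.
Proof.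
rewrite /Lint /Rintegral (@ge0_symfun_integralT _ (fun x : R => (1 + x ^+ 2)^-1)) //.
- rewrite -set_itvcy (_ : (\int[_]_(x in _) _)%E = (pi / 2)%:E).
    by rewrite /=; field.
  by rewrite -integral0y_oneDsqr.
- by move=> x; rewrite invr_ge0 ltW // sqD1_gt0.
- by cont => x; rewrite gt_eqF // sqD1_gt0.
- by move=> x /=; rewrite sqrrN.
Qed.

Lemma Lint_affine {R : realType} (f : R -> R) (a b : R) : 0 < a -> continuous f ->
  integr f -> integr (fun y => f (b + a * y)) /\ Lint f = a * Lint (fun y => f (b + a * y)).
Proof.
move=> a0 cf F.
pose A := fun y : R => b + a * y.
have dA (x : R) : is_derive x 1 A a by rewrite /A; deriv; ring.
have A' : derive1 A = fun _ => a.
  by apply/funext => x; rewrite derive1E (@derive_val _ _ _ _ _ _ _ (dA x)).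
(* The substitution rule is applied to nonnegative functions only; [f] is then recovered as the
   difference of |f| + f and |f|. *)
have key (g : R -> R) : continuous g -> (forall x, 0 <= g x) -> integr g ->
    integr (fun y => g (A y)) /\ Lint g = a * Lint (fun y => g (A y)).
  move=> cg g0 G.
  have cgA : continuous (fun y => g (A y)) by rewrite /A; cont.
  have := @increasing_ge0_integration_by_substitutionT R A g.
  rewrite A' LintE // => /(_ _ _ _ _ _ _ _ cg g0) h.
  have {}h : ((Lint g)%:E = \int[lebesgue_measure]_x (g (A x) * a)%:E)%E.
    apply: h.
    - by move=> x y xy; rewrite /A ltrD2l ltr_pM2l.
    - exact: cont_cst.
    - exact: is_cvg_cst.
    - exact: is_cvg_cst.
    - by move=> x; exact: (@ex_derive _ _ _ _ _ _ _ (dA x)).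
    - apply/cvgrNyPle => M; near=> x.
      have : x <= (M - b) / a by near: x; apply: nbhs_ninfty_le; rewrite num_real.
      by rewrite ler_pdivlMr // /A; lra.
    - apply/cvgryPge => M; near=> x.
      have : (M - b) / a <= x by near: x; apply: nbhs_pinfty_ge; rewrite num_real.
      by rewrite ler_pdivrMr // /A; lra.
  have I : integr (fun y => g (A y) * a).
    apply/integrableP; split.
      by apply/measurable_EFinP; apply: continuous_meas; cont.
    have p (x : R) : 0 <= g (A x) * a by apply: mulr_ge0 => //; exact: ltW.
    under eq_integral => x _ do rewrite /= ger0_norm //.
    by rewrite -h ltry.
  have I' : integr (fun y => g (A y)).
    have := integrZ a^-1 I; rewrite (_ : (fun x => _) = (fun y => g (A y))) //.
    by apply/funext => y; field; rewrite gt_eqF.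
  split=> //; move: h; rewrite LintE // => -[->].
  by rewrite -LintZ //; apply: eq_Lint => x; rewrite mulrC.
have cn : continuous (fun x => `|f x|) by cont.
have [n1 n2] := key _ cn (fun x => normr_ge0 _) (integr_norm F).
have [||p1 p2] := key (fun x => `|f x| + f x) _ _ (integrD (integr_norm F) F).
- by cont.
- by move=> x; have := ler_norm (- f x); rewrite normrN; lra.
have I : integr (fun y => f (A y)).
  have := integrB p1 n1; rewrite (_ : (fun x => _) = (fun y => f (A y))) //.
  by apply/funext => y; ring.
split=> //; move: p2; rewrite !LintD //; last exact: integr_norm.
rewrite n2 mulrDr; exact: addrI.
Unshelve. all: by end_near. Qed.

(** * The cosine transform of the resolvent kernel *)

Lemma cvg_continuous {R : realType} (h : R -> R) (u : nat -> R) (l : R) :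
  continuous h -> u n @[n --> \oo] --> l -> h (u n) @[n --> \oo] --> h l.
Proof. by move=> H; apply: continuous_cvg; exact: H. Qed.

Lemma expRN_le {R : realType} (u : R) : 0 < u -> expR (- u) <= u^-1.
Proof.
move=> u0; rewrite expRN lef_pV2 ?posrE ?expR_gt0 //.
by have := expR_ge1Dx u; lra.
Qed.

Lemma cvg_pinfty_exp0 {R : realType} (P : R -> R) (s C : R) : 0 < s ->
  (forall x, 0 <= x -> `|P x| <= C * expR (- (s * x))) -> P x @[x --> +oo] --> 0.
Proof.
move=> s0 b; apply/cvgr0Pnorm_lt => e e0; near=> x.
have x0 : 0 < x by near: x; apply: nbhs_pinfty_gt; rewrite num_real.
have C0 : 0 <= C by have := b _ (lexx 0); rewrite mulr0 oppr0 expR0 mulr1; apply: le_trans.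
apply: (le_lt_trans (b _ (ltW x0))).
apply: (@le_lt_trans _ _ (C * (s * x)^-1)).
  by rewrite ler_wpM2l // expRN_le // mulr_gt0.
rewrite ltr_pdivrMr ?mulr_gt0 //.
have : C / (e * s) < x by near: x; apply: nbhs_pinfty_gt; rewrite num_real.
by rewrite ltr_pdivrMr ?mulr_gt0 //; lra.
Unshelve. all: by end_near. Qed.

Lemma cvg_ninfty_exp0 {R : realType} (P : R -> R) (s C : R) : 0 < s ->
  (forall x, x <= 0 -> `|P x| <= C * expR (s * x)) -> P x @[x --> -oo] --> 0.
Proof.
move=> s0 b; apply/cvgNy_compNP; apply: (@cvg_pinfty_exp0 _ _ s C) => // x x0 /=.
by apply: le_trans (b _ _) _; rewrite ?mulrN // oppr_le0.
Qed.

Lemma Lint_exp_cos {R : realType} (s k t : R) : 0 < s ->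
  integr (fun y => expR (- (s * `|y|)) * cos (k * (y - t))) /\
  Lint (fun y => expR (- (s * `|y|)) * cos (k * (y - t))) =
    2 * s / (s ^+ 2 + k ^+ 2) * cos (k * t).
Proof.
move=> s0.
have n0 : s ^+ 2 + k ^+ 2 != 0 by rewrite gt_eqF // ltr_pwDl ?sqr_ge0 // exprn_gt0.
have I : integr (fun y => expR (- (s * `|y|)) * cos (k * (y - t))).
  apply: (integr_le (g := fun x => expR (- (s * `|x|)))); last exact: integr_exp.
    by apply: continuous_meas; cont.
  move=> y; rewrite normrM ger0_norm ?expR_ge0 // ler_piMr ?expR_ge0 //.
  by rewrite ler_norml cos_geN1 cos_le1.
split=> //.
pose q := (s ^+ 2 + k ^+ 2)^-1.
pose f1 := fun y => expR (- (s * y)) * cos (k * (y - t)).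
pose f2 := fun y => expR (s * y) * cos (k * (y - t)).
(* [P1] and [P2] are the real parts of the primitives of the complex exponentials e^(-s y + i k (y -
   t)) and e^(s y + i k (y - t)). *)
pose P1 := fun y => q * (expR (- (s * y)) * (k * sin (k * (y - t)) + - s * cos (k * (y - t)))).
pose P2 := fun y => q * (expR (s * y) * (k * sin (k * (y - t)) + s * cos (k * (y - t)))).
have bnd (a b u : R) : `|a * sin u + b * cos u| <= `|a| + `|b|.
  apply: (le_trans (ler_normD _ _)); rewrite !normrM; apply: lerD; apply: ler_piMr => //.
    by rewrite ler_norml sin_geN1 sin_le1.
  by rewrite ler_norml cos_geN1 cos_le1.
rewrite (_ : Lint _ = 0 - P1 0 + P2 0 - 0).
  rewrite /P1 /P2 (_ : k * (0 - t) = - (k * t)); last by ring.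
  rewrite mulr0 oppr0 expR0 cosN sinN /q.
  by field.
notypeclasses refine (@Lint_FTC_glue _ _ f1 f2 P1 P2 0 0 0 I _ _ _ _ _ _ _ _).
- by rewrite /f1; cont.
- by rewrite /f2; cont.
- by move=> x x0; rewrite /f1 ger0_norm.
- by move=> x x0; rewrite /f2 ler0_norm // mulrN opprK.
- by move=> x; rewrite /P1; deriv; rewrite /f1 /q; field.
- by move=> x; rewrite /P2; deriv; rewrite /f2 /q; field.
- apply: (@cvg_pinfty_exp0 _ _ s (`|q| * (`|k| + `|- s|))) => // x _.
  rewrite /P1 !normrM (ger0_norm (expR_ge0 _)) [leRHS]mulrAC -[leRHS]mulrA.
  by do 2 (apply: ler_wpM2l; rewrite ?expR_ge0 //).
- apply: (@cvg_ninfty_exp0 _ _ s (`|q| * (`|k| + `|s|))) => // x _.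
  rewrite /P2 !normrM (ger0_norm (expR_ge0 _)) [leRHS]mulrAC -[leRHS]mulrA.
  by do 2 (apply: ler_wpM2l; rewrite ?expR_ge0 //).
Qed.

Lemma sqD_gt0 {R : realType} (s k : R) : 0 < s -> 0 < s ^+ 2 + k ^+ 2.
Proof. by move=> s0; rewrite ltr_pwDl ?sqr_ge0 // exprn_gt0. Qed.

Lemma resolvent_decay {R : realType} (s k : R) : 0 < s ->
  (s ^+ 2 + k ^+ 2)^-1 <= (1 + (s ^+ 2)^-1) * (1 + k ^+ 2)^-1.
Proof.
move=> s0; have s2 : 0 < s ^+ 2 by rewrite exprn_gt0.
rewrite ler_pdivlMr ?sqD1_gt0 // mulrC ler_pdivrMr ?sqD_gt0 //.
rewrite -subr_ge0.
have -> : (1 + (s ^+ 2)^-1) * (s ^+ 2 + k ^+ 2) - (1 + k ^+ 2) = s ^+ 2 + k ^+ 2 * (s ^+ 2)^-1.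
  by field; rewrite gt_eqF.
by rewrite addr_ge0 // ?(ltW s2) // mulr_ge0 ?sqr_ge0 // invr_ge0 ltW.
Qed.

Lemma integr_resolvent {R : realType} (s : R) : 0 < s -> integr (fun k => (s ^+ 2 + k ^+ 2)^-1).
Proof.
move=> s0; apply: (@integr_decay _ _ (1 + (s ^+ 2)^-1)).
  by apply: continuous_meas; cont => x; rewrite gt_eqF // sqD_gt0.
by move=> x; rewrite ger0_norm ?invr_ge0 ?(ltW (sqD_gt0 _ _)) //; exact: resolvent_decay.
Qed.

Lemma abs_cos_le1 {R : realType} (x : R) : `|cos x| <= 1.
Proof. by rewrite ler_norml cos_geN1 cos_le1. Qed.

Lemma meas_fst {R : realType} (f : R -> R) : measurable_fun setT f ->
  measurable_fun setT (fun z : R * R => f z.1).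
Proof. by move=> F; apply: measurableT_comp => //; exact: measurable_fst. Qed.
Lemma meas_snd {R : realType} (f : R -> R) : measurable_fun setT f ->
  measurable_fun setT (fun z : R * R => f z.2).
Proof. by move=> F; apply: measurableT_comp => //; exact: measurable_snd. Qed.

(* The factor [expR (- (e * `|k|))] regularises the conditionally convergent
   double integral; after Fubini it becomes a Poisson kernel, and [e] is sent to 0. *)
Lemma Lint_cos_resolvent {R : realType} (s t : R) : 0 < s ->
  Lint (fun k => (s ^+ 2 + k ^+ 2)^-1 * cos (k * t)) = pi / s * expR (- (s * `|t|)).
Proof.
move=> s0.
pose A (e : R) := Lint (fun k => expR (- (e * `|k|)) * ((s ^+ 2 + k ^+ 2)^-1 * cos (k * t))).
have AE (e : R) : 0 < e ->
    A e = s^-1 * Lint (fun u => (1 + u ^+ 2)^-1 * expR (- (s * `|t + e * u|))).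
  move=> e0.
  pose F := fun z : R * R => expR (- (e * `|z.1|)) * (expR (- (s * `|z.2|)) * cos (z.1 * (z.2 - t))).
  have mF : measurable_fun setT F.
    apply: measurable_funM; first by apply: (meas_fst (f := fun x => expR (- (e * `|x|)))); apply: continuous_meas; cont.
    apply: measurable_funM; first by apply: (meas_snd (f := fun x => expR (- (s * `|x|)))); apply: continuous_meas; cont.
    apply: measurableT_comp; first by apply: continuous_meas; exact: continuous_cos.
    apply: measurable_funM; first exact: measurable_fst.
    by apply: (meas_snd (f := fun x => x - t)); apply: continuous_meas; cont.
  have bF x y : `|F (x, y)| <= expR (- (e * `|x|)) * expR (- (s * `|y|)).
    rewrite /F /= !normrM !(ger0_norm (expR_ge0 _)) ler_wpM2l ?expR_ge0 //.
    by rewrite ler_piMr ?expR_ge0 // abs_cos_le1.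
  have [I1 I2 E] := Lint_fubini mF (integr_exp e0) (integr_exp s0) bF.
  have E1 : (fun x => Lint (fun y => F (x, y))) =
      (fun k => (2 * s) * (expR (- (e * `|k|)) * ((s ^+ 2 + k ^+ 2)^-1 * cos (k * t)))).
    apply/funext => k; rewrite /F /= LintZ; last exact: (Lint_exp_cos _ _ s0).1.
    by rewrite (Lint_exp_cos _ _ s0).2; ring.
  pose G y := expR (- (s * `|y|)) * (2 * e * (e ^+ 2 + (y - t) ^+ 2)^-1).
  have E2 : (fun y => Lint (fun x => F (x, y))) = G.
    apply/funext => y; rewrite /F /G /=.
    transitivity (Lint (fun x => expR (- (s * `|y|)) * (expR (- (e * `|x|)) * cos ((y - t) * (x - 0))))).
      by apply: eq_Lint => x; rewrite subr0 (mulrC (y - t)); ring.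
    rewrite LintZ; last exact: (Lint_exp_cos _ _ e0).1.
    by rewrite (Lint_exp_cos _ _ e0).2 mulr0 cos0; ring.
  rewrite E1 E2 in E I1 I2.
  have cG : continuous G.
    by rewrite /G; cont => x; rewrite gt_eqF // sqD_gt0.
  (* The substitution y = t + e u turns the kernel of width [e] into the fixed density (1 + u^2)^-1,
     so that letting [e] tend to 0 becomes a matter of dominated convergence. *)
  have [_ h] := Lint_affine t e0 cG I2.
  have IA : integr (fun k => expR (- (e * `|k|)) * ((s ^+ 2 + k ^+ 2)^-1 * cos (k * t))).
    have := integrZ (2 * s)^-1 I1; congr integr; apply/funext => k.
    by rewrite mulKf // gt_eqF // mulr_gt0.
  have s2 : 2 * s != 0 by rewrite gt_eqF // mulr_gt0.
  apply: (mulfI s2); rewrite -[LHS]LintZ // E h.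
  rewrite (mulrA _ s^-1) mulfK ?gt_eqF //.
  have Iu : integr (fun u => (1 + u ^+ 2)^-1 * expR (- (s * `|t + e * u|))).
    apply: (@integr_decay _ _ 1).
      by apply: continuous_meas; cont => x; rewrite gt_eqF // sqD1_gt0.
    move=> u; rewrite mul1r normrM (ger0_norm (expR_ge0 _)) ger0_norm ?invr_ge0 ?(ltW (sqD1_gt0 _)) //.
    rewrite ler_piMr ?invr_ge0 ?(ltW (sqD1_gt0 _)) // -expR0 ler_expR oppr_le0 mulr_ge0 // ltW //.
  rewrite -!LintZ //.
    apply: eq_Lint => u; rewrite /G (_ : t + e * u - t = e * u); last by ring.
    rewrite exprMn; field; have := sqD1_gt0 u => h1.
    by rewrite !gt_eqF //; nra.
  have := (Lint_affine t e0 cG I2).1; congr integr.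
pose ep (n : nat) : R := n.+1%:R^-1.
have ep0 n : 0 < ep n by rewrite invr_gt0.
have epc : ep n @[n --> \oo] --> (0 : R) by exact: cvg_harmonic.
have cs (z : R) : expR (- (ep n * z)) @[n --> \oo] --> (1 : R).
  rewrite -[X in _ --> X]expR0 -[X in expR X]oppr0 -(mul0r z).
  apply: (cvg_comp (fun n => - (ep n * z)) expR); last exact: continuous_expR.
  by apply: cvgN; apply: cvgM => //; exact: cvg_cst.
have le1 (u v : R) : 0 <= u -> expR (- (u * `|v|)) <= 1.
  by move=> u0; rewrite -expR0 ler_expR oppr_le0 mulr_ge0.
have q0 (k : R) : 0 <= (s ^+ 2 + k ^+ 2)^-1 by rewrite invr_ge0 ltW // sqD_gt0.
have l1 : A (ep n) @[n --> \oo] --> Lint (fun k => (s ^+ 2 + k ^+ 2)^-1 * cos (k * t)).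
  apply: (Lint_dct (g := fun k => (s ^+ 2 + k ^+ 2)^-1) _ _ _ _).2.
  - by move=> n; apply: continuous_meas; cont => x; rewrite gt_eqF // sqD_gt0.
  - exact: integr_resolvent.
  - move=> n k; rewrite !normrM (ger0_norm (expR_ge0 _)) (ger0_norm (q0 k)).
    rewrite (le_trans (y := 1 * ((s ^+ 2 + k ^+ 2)^-1 * 1))) //; last by rewrite mul1r mulr1.
    apply: ler_pM; rewrite ?expR_ge0 ?mulr_ge0 //; first by rewrite le1 // ltW.
    by rewrite ler_wpM2l // abs_cos_le1.
  - move=> k; rewrite -[X in _ --> X]mul1r.
    by apply: cvgM; [exact: cs|exact: cvg_cst].
have l2 : A (ep n) @[n --> \oo] --> s^-1 * Lint (fun u => (1 + u ^+ 2)^-1 * expR (- (s * `|t|))).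
  under eq_fun do rewrite AE //.
  apply: cvgM; first exact: cvg_cst.
  apply: (Lint_dct (g := fun k => (1 + k ^+ 2)^-1) _ _ _ _).2.
  - by move=> n; apply: continuous_meas; cont => x; rewrite gt_eqF // sqD1_gt0.
  - exact: integr_oneDsqrV.
  - move=> n k; rewrite !normrM (ger0_norm (expR_ge0 _)) ger0_norm ?invr_ge0 ?(ltW (sqD1_gt0 _)) //.
    by rewrite ler_piMr ?invr_ge0 ?(ltW (sqD1_gt0 _)) // le1 // ltW.
  - move=> u; apply: cvgM; first exact: cvg_cst.
    have ce : continuous (fun y : R => expR (- (s * `|y|))) by cont.
    apply: (cvg_continuous ce).
    rewrite -[X in _ --> X]addr0 -(mul0r u); apply: cvgD; first exact: cvg_cst.
    by apply: cvgM => //; exact: cvg_cst.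
rewrite (cvg_unique _ l1 l2) //.
under eq_Lint do rewrite mulrC.
rewrite LintZ; last exact: integr_oneDsqrV.
by rewrite Lint_oneDsqrV; field; rewrite gt_eqF.
Qed.

(** * Fourier multipliers on smooth compactly supported functions *)

Definition csupp {R : realType} (K : R) (f : R -> R) : Prop :=
  forall x, K < `|x| -> f x = 0.

Lemma csupp_bounded {R : realType} (K : R) (f : R -> R) : continuous f -> csupp K f ->
  exists2 M, 0 <= M & forall x, `|f x| <= M.
Proof.
move=> cf sf.
have K0 : - `|K| <= `|K| by have := normr_ge0 K; lra.
have cn : {within `[- `|K|, `|K|], continuous (fun x => `|f x|)}.
  by apply: continuous_subspaceT; cont.
have [c _ h] := EVT_max K0 cn.
exists `|f c| => // x; have [xK|Kx] := leP `|x| `|K|.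
  by apply: h; rewrite in_itv /= -ler_norml.
by rewrite sf ?normr0 // (le_lt_trans (ler_norm K)).
Qed.

Lemma csupp_exp_bound {R : realType} (K M s : R) (f : R -> R) : csupp K f -> 0 <= s ->
  (forall x, `|f x| <= M) -> forall x, `|f x| <= M * expR (s * K) * expR (- (s * `|x|)).
Proof.
move=> sf s0 b x; have M0 : 0 <= M by apply: le_trans (b 0).
have [xK|Kx] := leP `|x| K; last by rewrite sf // normr0 !mulr_ge0 ?expR_ge0.
apply: (le_trans (b x)); rewrite -mulrA -expRD -[leLHS]mulr1 ler_wpM2l //.
by rewrite -expR0 ler_expR -mulrBr mulr_ge0 // subr_ge0.
Qed.

Lemma integr_csupp {R : realType} (K : R) (f : R -> R) : continuous f -> csupp K f -> integr f.
Proof.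
move=> cf sf; have [M M0 b] := csupp_bounded cf sf.
apply: (integr_le (g := fun x => M * expR (1 * K) * expR (- (1 * `|x|)))).
- exact: continuous_meas.
- exact: csupp_exp_bound.
- by apply: integrZ; exact: integr_exp.
Qed.

Lemma csupp_mul {R : realType} (K : R) (f g : R -> R) : csupp K f ->
  csupp K (fun x => f x * g x).
Proof. by move=> sf x h; rewrite sf // mul0r. Qed.

Lemma csupp_derive {R : realType} (K : R) (f df : R -> R) :
  (forall x : R, is_derive x 1 f (df x)) -> csupp K f -> csupp K df.
Proof.
move=> d sf x Kx.
have e : \near x, f x = cst 0 x.
  have c : continuous (fun y : R => `|y|) by cont.
  near=> y; apply: sf; near: y.
  exact: (cvgr_gt _ (c x) _ Kx).
have := near_eq_derive (1 : R) e.
by rewrite (@derive_val _ _ _ _ _ _ _ (d x)) derive_cst.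
Unshelve. all: by end_near. Qed.

Lemma cvg_pinfty_csupp {R : realType} (K : R) (f : R -> R) : csupp K f -> f x @[x --> +oo] --> (0 : R).
Proof.
move=> sf; apply: cvg_near_cst; near=> x; apply: sf.
apply: lt_le_trans (ler_norm x).
by near: x; apply: nbhs_pinfty_gt; rewrite num_real.
Unshelve. all: by end_near. Qed.

Lemma cvg_ninfty_csupp {R : realType} (K : R) (f : R -> R) : csupp K f -> f x @[x --> -oo] --> (0 : R).
Proof.
move=> sf; apply/cvgNy_compNP/(@cvg_pinfty_csupp _ K) => x /= h.
by apply: sf; rewrite normrN.
Qed.

Lemma Lint_derive_csupp {R : realType} (K : R) (F f : R -> R) :
  (forall x : R, is_derive x 1 F (f x)) -> continuous f -> csupp K F -> Lint f = 0.
Proof.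
move=> d c s; rewrite -[RHS](subrr 0).
notypeclasses refine (@Lint_FTC _ f F 0 0 _ c d (cvg_pinfty_csupp s) (cvg_ninfty_csupp s)).
exact: (integr_csupp c (csupp_derive d s)).
Qed.

(* The convolution of [f] with the fundamental solution of [s^2 - D^2]. *)
Definition expconv {R : realType} (s : R) (f : R -> R) (x : R) : R :=
  (2 * s)^-1 * Lint (fun y => f y * expR (- (s * `|x - y|))).

Lemma integr_expconv {R : realType} (s x K : R) (f : R -> R) : continuous f -> csupp K f ->
  integr (fun y => f y * expR (- (s * `|x - y|))).
Proof.
move=> cf sf; apply: (@integr_csupp _ K); first by cont.
exact: csupp_mul.
Qed.

(** Two integrations by parts on each side of [x]; the jump at [x] of the derivative of the kernel
    produces the term [- f x]. *)
Lemma expconv_derive2 {R : realType} (s K : R) (f f1 f2 : R -> R) : 0 < s ->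
  (forall x : R, is_derive x 1 f (f1 x)) -> (forall x : R, is_derive x 1 f1 (f2 x)) ->
  continuous f2 -> csupp K f ->
  forall x, expconv s f2 x = s ^+ 2 * expconv s f x - f x.
Proof.
move=> s0 d1 d2 c2 sp x.
have s1 := csupp_derive d1 sp; have s2 := csupp_derive d2 s1.
have c1 := is_derive_continuous d2; have c0 := is_derive_continuous d1.
have I2 := integr_expconv s x c2 s2; have I0 := integr_expconv s x c0 sp.
pose g y := (f2 y - s ^+ 2 * f y) * expR (- (s * `|x - y|)).
have gE : g = fun y => f2 y * expR (- (s * `|x - y|)) - s ^+ 2 * (f y * expR (- (s * `|x - y|))).
  by apply/funext => y; rewrite /g; ring.
have : Lint g = - (2 * s * f x).
  pose P1 y := expR (- (s * (y - x))) * (f1 y + s * f y).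
  pose P2 y := expR (s * (y - x)) * (f1 y - s * f y).
  have K1 : csupp K P1 by move=> y h; rewrite /P1 sp // s1 // mulr0 addr0 mulr0.
  have K2 : csupp K P2 by move=> y h; rewrite /P2 sp // s1 // mulr0 subr0 mulr0.
  have -> : - (2 * s * f x) = 0 - P1 x + P2 x - 0.
    by rewrite /P1 /P2 subrr mulr0 oppr0 expR0; ring.
  notypeclasses refine (@Lint_FTC_glue _ g
    (fun y => (f2 y - s ^+ 2 * f y) * expR (- (s * (y - x))))
    (fun y => (f2 y - s ^+ 2 * f y) * expR (s * (y - x))) P1 P2 x 0 0 _ _ _ _ _ _ _
    (cvg_pinfty_csupp K1) (cvg_ninfty_csupp K2)).
  - by rewrite gE; apply: integrB => //; exact: integrZ.
  - by cont.
  - by cont.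
  - by move=> y xy; rewrite /g distrC ger0_norm // subr_ge0.
  - by move=> y xy; rewrite /g ger0_norm ?subr_ge0 //; congr (_ * expR _); ring.
  - by move=> y; rewrite /P1; deriv; [exact: d2|exact: d1|ring].
  - by move=> y; rewrite /P2; deriv; [exact: d2|exact: d1|ring].
rewrite gE LintB //; last exact: integrZ.
rewrite LintZ // /expconv => /eqP; rewrite subr_eq => /eqP ->.
by field; rewrite gt_eqF.
Qed.

(** The exchange of k^2 for two derivatives serves twice: it gives decay in k, and it turns the
    terms k^2 / (s^2 + k^2) of the symbol into resolvent symbols acting on f''. *)
Lemma Lint_cos_derive2 {R : realType} (K : R) (f f1 f2 : R -> R) :
  (forall x : R, is_derive x 1 f (f1 x)) -> (forall x : R, is_derive x 1 f1 (f2 x)) ->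
  continuous f2 -> csupp K f ->
  forall k x, Lint (fun y => f2 y * cos (k * (x - y))) =
    - (k ^+ 2 * Lint (fun y => f y * cos (k * (x - y)))).
Proof.
move=> d1 d2 c2 s k x.
have s1 := csupp_derive d1 s; have s2 := csupp_derive d2 s1.
have c1 := is_derive_continuous d2; have c0 := is_derive_continuous d1.
have I2 : integr (fun y => f2 y * cos (k * (x - y))).
  by apply: (@integr_csupp _ K); [cont|exact: csupp_mul].
have I0 : integr (fun y => f y * cos (k * (x - y))).
  by apply: (@integr_csupp _ K); [cont|exact: csupp_mul].
rewrite -LintZ //; apply/eqP; rewrite -addr_eq0 -LintD //; last exact: integrZ.
apply/eqP.
pose P y := f1 y * cos (k * (x - y)) - f y * (k * sin (k * (x - y))).
notypeclasses refine (@Lint_derive_csupp _ K P _ _ _ _).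
- by move=> y; rewrite /P; deriv; [exact: d2|exact: d1|ring].
- by cont.
- by move=> y h; rewrite /P s // s1 // !mul0r subr0.
Qed.

(** The resolvent symbol is itself integrable in k, so Fubini applies directly and the inner
    integral is the cosine transform already computed. *)
Lemma fmult_resolvent {R : realType} (s K : R) (f : R -> R) : 0 < s ->
  continuous f -> csupp K f ->
  forall x, integr (fun k => (s ^+ 2 + k ^+ 2)^-1 * Lint (fun y => f y * cos (k * (x - y)))) /\
    fmult (fun k => (s ^+ 2 + k ^+ 2)^-1) f x = expconv s f x.
Proof.
move=> s0 cf sf x.
pose F := fun z : R * R => (s ^+ 2 + z.1 ^+ 2)^-1 * (f z.2 * cos (z.1 * (x - z.2))).
have cq : continuous (fun k : R => (s ^+ 2 + k ^+ 2)^-1).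
  by cont => k; rewrite gt_eqF // sqD_gt0.
have q0 (k : R) : 0 <= (s ^+ 2 + k ^+ 2)^-1 by rewrite invr_ge0 ltW // sqD_gt0.
have mF : measurable_fun setT F.
  apply: measurable_funM; first by apply: (meas_fst (f := fun k => (s ^+ 2 + k ^+ 2)^-1)); exact: continuous_meas.
  apply: measurable_funM; first by apply: meas_snd; exact: continuous_meas.
  apply: measurableT_comp; first by apply: continuous_meas; exact: continuous_cos.
  apply: measurable_funM; first exact: measurable_fst.
  by apply: (meas_snd (f := fun y => x - y)); apply: continuous_meas; cont.
have If := integr_csupp cf sf.
have bF k y : `|F (k, y)| <= (s ^+ 2 + k ^+ 2)^-1 * `|f y|.
  rewrite /F /= !normrM ger0_norm // ler_wpM2l // ler_piMr // abs_cos_le1 //.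
have [I _ E] := Lint_fubini mF (integr_resolvent s0) (integr_norm If) bF.
have FE : (fun k => Lint (fun y => F (k, y))) =
    (fun k => (s ^+ 2 + k ^+ 2)^-1 * Lint (fun y => f y * cos (k * (x - y)))).
  apply/funext => k; rewrite /F /= LintZ //.
  by apply: (@integr_csupp _ K); [cont|exact: csupp_mul].
rewrite FE in I E.
split=> //; rewrite /fmult /expconv E.
transitivity ((2 * pi)^-1 * Lint (fun y => pi / s * (f y * expR (- (s * `|x - y|))))).
  congr (_ * _); apply: eq_Lint => y; rewrite /F /=.
  transitivity (f y * Lint (fun k => (s ^+ 2 + k ^+ 2)^-1 * cos (k * (x - y)))).
    rewrite -LintZ; first by apply: eq_Lint => k; ring.
    apply: (integr_le (g := fun k => (s ^+ 2 + k ^+ 2)^-1)).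
    - by apply: continuous_meas; cont.
    - by move=> k; rewrite normrM ger0_norm // ler_piMr // abs_cos_le1.
    - exact: integr_resolvent.
  by rewrite Lint_cos_resolvent //; ring.
rewrite LintZ; last exact: (integr_expconv s x cf sf).
have := pi_gt0 R; move: (pi : R) => p p0.
by field; rewrite !gt_eqF.
Qed.

(** Fourier inversion, deduced from the resolvent: the transform of f is (1 + k^2)^-1 times that of
    f - f'', and the resolvent of 1 - D^2 maps f - f'' back to f. *)
Lemma fmult1 {R : realType} (K : R) (f f1 f2 : R -> R) :
  (forall x : R, is_derive x 1 f (f1 x)) -> (forall x : R, is_derive x 1 f1 (f2 x)) ->
  continuous f2 -> csupp K f -> forall x, fmult (fun => 1) f x = f x.
Proof.
move=> d1 d2 c2 s x.
have s1 := csupp_derive d1 s; have s2 := csupp_derive d2 s1.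
have c1 := is_derive_continuous d2; have c0 := is_derive_continuous d1.
transitivity (fmult (fun k => (1 ^+ 2 + k ^+ 2)^-1) (fun y => f y - f2 y) x).
  congr (_ * _); apply: eq_Lint => k; rewrite mul1r.
  have I2 : integr (fun y => f2 y * cos (k * (x - y))).
    by apply: (@integr_csupp _ K); [cont|exact: csupp_mul].
  have I0 : integr (fun y => f y * cos (k * (x - y))).
    by apply: (@integr_csupp _ K); [cont|exact: csupp_mul].
  under [in RHS]eq_Lint do rewrite mulrBl.
  rewrite LintB // (Lint_cos_derive2 d1 d2 c2 s) expr1n opprK.
  move: (Lint _) => L; have := sqD1_gt0 k => h.
  by field; rewrite gt_eqF.
have cB : continuous (fun y => f y - f2 y) by cont.
have sB : csupp K (fun y => f y - f2 y) by move=> y h; rewrite s // s2 // subrr.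
rewrite (fmult_resolvent ltr01 cB sB x).2.
transitivity (expconv 1 f x - expconv 1 f2 x).
  rewrite /expconv -mulrBr -LintB; [|exact: (integr_expconv _ _ c0 s)|exact: (integr_expconv _ _ c2 s2)].
  by congr (_ * _); apply: eq_Lint => y; ring.
by rewrite (expconv_derive2 _ d1 d2 c2 s) // expr1n; ring.
Qed.

(** * Partial fractions of the hyperbolic cotangent *)

Definition Ihalfpi {R : realType} (f : R -> R) : R :=
  Rintegral (@lebesgue_measure R) `[0, pi / 2] f.

Lemma halfpi_ge0 {R : realType} : 0 <= pi / 2 :> R.
Proof. by rewrite divr_ge0 ?pi_ge0. Qed.

Lemma cont_Ihalfpi {R : realType} (f : R -> R) : continuous f ->
  (@lebesgue_measure R).-integrable `[0, pi / 2] (EFin \o f).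
Proof.
move=> cf; apply: continuous_compact_integrable; first exact: segment_compact.
exact: continuous_subspaceT.
Qed.

Lemma IhalfpiZ {R : realType} k (f : R -> R) : continuous f -> Ihalfpi (fun t => k * f t) = k * Ihalfpi f.
Proof. by move=> cf; rewrite /Ihalfpi RintegralZl //; exact: cont_Ihalfpi. Qed.
Lemma IhalfpiD {R : realType} (f g : R -> R) : continuous f -> continuous g ->
  Ihalfpi (fun t => f t + g t) = Ihalfpi f + Ihalfpi g.
Proof. by move=> cf cg; rewrite /Ihalfpi RintegralD //; exact: cont_Ihalfpi. Qed.
Lemma Ihalfpi_le {R : realType} (f g : R -> R) : continuous f -> continuous g ->
  (forall t, 0 <= t <= pi / 2 -> f t <= g t) -> Ihalfpi f <= Ihalfpi g.
Proof.
move=> cf cg h; apply: (le_Rintegral _ (cont_Ihalfpi cf) (cont_Ihalfpi cg)) => //.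
Qed.
Lemma Ihalfpi_FTC {R : realType} (f P : R -> R) : continuous f ->
  (forall x : R, is_derive x 1 P (f x)) -> Ihalfpi f = P (pi / 2) - P 0.
Proof. by move=> cf d; exact: (Rintegral_FTC halfpi_ge0 cf d). Qed.

(** [expC x t] and [expS x t] are 2 cosh (2 x t) and 2 sinh (2 x t); the factor 2 in the argument
    makes the endpoint pi/2 yield pi x. *)
Definition expC {R : realType} (x t : R) : R := expR (2 * x * t) + expR (- (2 * x * t)).
Definition expS {R : realType} (x t : R) : R := expR (2 * x * t) - expR (- (2 * x * t)).
Lemma continuous_expC {R : realType} (x : R) : continuous (expC x).
Proof. by rewrite (_ : expC x = fun t => expC x t) // /expC; cont. Qed.
Lemma continuous_expS {R : realType} (x : R) : continuous (expS x).
Proof. by rewrite (_ : expS x = fun t => expS x t) // /expS; cont. Qed.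
(** A hyperbolic form of the Wallis integrals. At n = 0 it equals sinh (pi x) / x, whose logarithmic
    derivative in [x] is pi coth (pi x) - 1/x. *)
Definition cosmom {R : realType} (x : R) (n : nat) : R := Ihalfpi (fun t => expC x t * cos t ^+ n).
(* the derivative of [cosmom x n] with respect to [x] *)
Definition dcosmom {R : realType} (x : R) (n : nat) : R :=
  Ihalfpi (fun t => 2 * t * expS x t * cos t ^+ n).

(** Two integrations by parts; the boundary terms vanish because of the cosine at pi/2 and of [expS]
    and the sine at 0. *)
Lemma cosmom_rec {R : realType} (x : R) (m : nat) :
  ((2 * x) ^+ 2 + m.+2%:R ^+ 2) * cosmom x m.+2 = m.+2%:R * m.+1%:R * cosmom x m.
Proof.
have cC := @continuous_expC R x; have cS := @continuous_expS R x.
have c n : continuous (fun t : R => expC x t * cos t ^+ n) by cont.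
apply/eqP; rewrite -subr_eq0 -mulNr -IhalfpiZ // -IhalfpiZ // -IhalfpiD; [|by cont..].
pose P t : R := 2 * x * expS x t * cos t ^+ m.+2 + m.+2%:R * expC x t * cos t ^+ m.+1 * sin t.
rewrite (_ : Ihalfpi _ = P (pi / 2) - P 0); last notypeclasses refine (Ihalfpi_FTC (P := P) _ _).
- by rewrite /P cos_pihalf sin0 !exprS /expS mulr0 oppr0 !expR0; apply/eqP; ring.
- by rewrite /expC; cont.
move=> t; rewrite /P /expC /expS; deriv.
have : cos t ^+ m.+2 = cos t ^+ m * (1 - sin t ^+ 2) by rewrite -cos2sin2 -exprD addn2.
rewrite !exprS => e.
have {e} : sin t * sin t * cos t ^+ m = cos t ^+ m - cos t * (cos t * cos t ^+ m).
  by rewrite e; ring.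
rewrite [m.+2%:R]mulrS [m.+1%:R]mulrS.
move: (cos t ^+ m) => cm e.
set E1 := expR _; set E2 := expR _.
transitivity ((2 * x) * (2 * x) * (E1 + E2) * (cos t * (cos t * cm)) +
  (1 + (1 + m%:R)) * (E1 + E2) * ((cos t * (cos t * cm)) - (1 + m%:R) * (sin t * sin t * cm))).
  by ring.
by rewrite e; ring.
Qed.

Lemma dcosmom_rec {R : realType} (x : R) (m : nat) :
  ((2 * x) ^+ 2 + m.+2%:R ^+ 2) * dcosmom x m.+2 + 8 * x * cosmom x m.+2 =
  m.+2%:R * m.+1%:R * dcosmom x m.
Proof.
have cC := @continuous_expC R x; have cS := @continuous_expS R x.
have c n : continuous (fun t : R => expC x t * cos t ^+ n) by cont.
have c' n : continuous (fun t : R => 2 * t * expS x t * cos t ^+ n) by cont.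
apply/eqP; rewrite -subr_eq0 -mulNr -!IhalfpiZ // -!IhalfpiD; [|by cont..].
(* The derivative in [x] of the primitive used for [cosmom_rec], which avoids differentiating under
   the integral sign. *)
pose P t : R := (2 * expS x t + 4 * x * t * expC x t) * cos t ^+ m.+2 +
  m.+2%:R * (2 * t * expS x t) * cos t ^+ m.+1 * sin t.
rewrite (_ : Ihalfpi _ = P (pi / 2) - P 0); last notypeclasses refine (Ihalfpi_FTC (P := P) _ _).
- by rewrite /P cos_pihalf sin0 !exprS /expS mulr0 oppr0 !expR0; apply/eqP; ring.
- by rewrite /expC /expS; cont.
move=> t; rewrite /P /expC /expS; deriv.
have : cos t ^+ m.+2 = cos t ^+ m * (1 - sin t ^+ 2) by rewrite -cos2sin2 -exprD addn2.
rewrite !exprS => e.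
have {e} : sin t * sin t * cos t ^+ m = cos t ^+ m - cos t * (cos t * cos t ^+ m).
  by rewrite e; ring.
rewrite [m.+2%:R]mulrS [m.+1%:R]mulrS.
move: (cos t ^+ m) => cm e.
set E1 := expR _; set E2 := expR _.
transitivity ((2 * x) * (2 * x) * (2 * t * (E1 - E2)) * (cos t * (cos t * cm)) +
  8 * x * (E1 + E2) * (cos t * (cos t * cm)) +
  (1 + (1 + m%:R)) * (2 * t * (E1 - E2)) * ((cos t * (cos t * cm)) - (1 + m%:R) * (sin t * sin t * cm))).
  by ring.
by rewrite e; ring.
Qed.

Lemma cosmom0 {R : realType} (x : R) : x != 0 ->
  cosmom x 0 = (expR (pi * x) - expR (- (pi * x))) / (2 * x).
Proof.
move=> x0; rewrite /cosmom.
pose P t : R := expS x t * (2 * x)^-1.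
rewrite (_ : Ihalfpi _ = P (pi / 2) - P 0); last notypeclasses refine (Ihalfpi_FTC (P := P) _ _).
- rewrite /P /expS mulr0 oppr0 expR0 subrr mul0r subr0.
  by rewrite (_ : 2 * x * (pi / 2) = pi * x) //; move: (pi : R) => p; field.
- by rewrite /expC; cont.
- by move=> t; rewrite /P /expS /expC; deriv; rewrite expr0; field.
Qed.

Lemma dcosmom0 {R : realType} (x : R) : x != 0 ->
  dcosmom x 0 = (pi * (expR (pi * x) + expR (- (pi * x))) -
    (expR (pi * x) - expR (- (pi * x))) / x) / (2 * x).
Proof.
move=> x0; rewrite /dcosmom.
pose P t : R := t * expC x t * x^-1 - expS x t * (2 * x * x)^-1.
rewrite (_ : Ihalfpi _ = P (pi / 2) - P 0); last notypeclasses refine (Ihalfpi_FTC (P := P) _ _).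
- rewrite /P /expS /expC mulr0 oppr0 expR0.
  rewrite (_ : 2 * x * (pi / 2) = pi * x); last by move: (pi : R) => p; field.
  move: (pi : R) => p; move: (expR (p * x)) => a; move: (expR _) => b.
  by field.
- by rewrite /expS; cont.
- by move=> t; rewrite /P /expS /expC; deriv; rewrite expr0; field.
Qed.

(** This is t <= tan t, written so as to include pi/2; the difference is the integral of u sin u. *)
Lemma mulcos_le_sin {R : realType} (t : R) : 0 <= t <= pi / 2 -> t * cos t <= sin t.
Proof.
move=> /andP[t0 t1]; rewrite -subr_ge0.
have : Rintegral (@lebesgue_measure R) `[0, t] (fun u => u * sin u) = (sin t - t * cos t) - (sin 0 - 0 * cos 0).
  notypeclasses refine (@Rintegral_FTC _ _ (fun u => sin u - u * cos u) _ _ t0 _ _); first by cont.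
  by move=> u; deriv; ring.
rewrite sin0 mul0r !subr0 => <-.
apply: Rintegral_ge0 => u /=; rewrite in_itv /= => /andP[u0 ut].
rewrite mulr_ge0 // sin_ge0_pi // u0 /= (le_trans ut) // (le_trans t1) //.
by have := pi_ge0 R; lra.
Qed.

Lemma cos_halfpi_ge0 {R : realType} (t : R) : 0 <= t <= pi / 2 -> 0 <= cos t.
Proof.
move=> /andP[t0 t1]; apply: cos_ge0_pihalf; rewrite t1 andbT.
by have := @halfpi_ge0 R; lra.
Qed.

Lemma expC_ge2 {R : realType} (x t : R) : 2 <= expC x t.
Proof.
rewrite /expC expRN; have := expR_gt0 (2 * x * t); move: (expR _) => u u0.
rewrite -subr_ge0 (_ : u + u^-1 - 2 = (u - 1) ^+ 2 / u); last by field; rewrite gt_eqF.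
by rewrite divr_ge0 ?sqr_ge0 // ltW.
Qed.

Lemma expS_le {R : realType} (x t : R) : 0 <= x -> 0 <= t <= pi / 2 ->
  0 <= expS x t <= 4 * x * t * expR (pi * x).
Proof.
move=> x0 /andP[t0 t1]; rewrite /expS.
have u0 : 0 <= 2 * x * t by rewrite !mulr_ge0.
have u1 : 2 * x * t <= pi * x by rewrite -mulrA mulrCA (mulrC x) ler_wpM2r //; lra.
apply/andP; split; first by rewrite subr_ge0 ler_expR; lra.
have -> : expR (- (2 * x * t)) = expR (2 * x * t) * expR (- (2 * (2 * x * t))).
  by rewrite -expRD; congr expR; ring.
rewrite -[X in X - _]mulr1 -mulrBr mulrC ler_pM ?expR_ge0 //.
- by rewrite subr_ge0 -[leRHS]expR0 ler_expR; lra.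
- by have := expR_ge1Dx (- (2 * (2 * x * t))); lra.
- by rewrite ler_expR.
Qed.

Lemma cosmom_gt0 {R : realType} (x : R) (m : nat) : 0 < cosmom x m.*2.
Proof.
elim: m => [|m IH].
  apply: (@lt_le_trans _ _ (Ihalfpi (fun _ : R => 2))).
    pose P t : R := 2 * t.
    rewrite (_ : Ihalfpi _ = P (pi / 2) - P 0); last notypeclasses refine (Ihalfpi_FTC (P := P) _ _).
    - by rewrite /P mulr0 subr0 mulr_gt0 // divr_gt0 // pi_gt0.
    - by cont.
    - by move=> t; rewrite /P; deriv; ring.
  apply: Ihalfpi_le => [||t _]; [by cont|by rewrite /expC; cont|].
  by rewrite expr0 mulr1 expC_ge2.
rewrite doubleS; have e := cosmom_rec x m.*2.
have p : 0 < (2 * x) ^+ 2 + m.*2.+2%:R ^+ 2 :> R by rewrite ltr_wpDl ?sqr_ge0 // exprn_gt0.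
by rewrite -(pmulr_rgt0 _ p) e mulr_gt0 // mulr_gt0.
Qed.

(** Since [expS x t] is at most linear in t, the integrand of [dcosmom] is bounded by a multiple of
    (t cos t)^2 cos^n t <= (1 - cos^2 t) cos^n t. The integral of the latter is a difference of
    consecutive Wallis integrals, which is smaller than either by a factor of order n; and [cosmom]
    at 0 bounds [cosmom] at [x] from below. *)
Lemma dcosmom_bound {R : realType} (x : R) (m : nat) : 0 < x ->
  0 <= dcosmom x m.*2.+2 / cosmom x m.*2.+2 <= 8 * x * expR (pi * x) / m.*2.+1%:R.
Proof.
move=> x0; set n := m.*2.
have A0 : 0 < cosmom x n.+2 by exact: (cosmom_gt0 x m.+1).
have D0 : 0 < cosmom (0:R) n.+2 by exact: (cosmom_gt0 0 m.+1).
have S t : 0 <= t <= pi / 2 -> 0 <= expS x t <= 4 * x * t * expR (pi * x) by apply: expS_le; exact: ltW.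
have cC y := @continuous_expC R y; have cS' := @continuous_expS R x.
have cS k : continuous (fun t : R => 2 * t * expS x t * cos t ^+ k) by cont.
have cA (y : R) k : continuous (fun t : R => expC y t * cos t ^+ k) by cont; exact: cC.
apply/andP; split.
  apply: divr_ge0; last exact: ltW.
  apply: Rintegral_ge0 => t /=; rewrite in_itv /= => h.
  have /andP[S0 _] := S t h; have c0 := cos_halfpi_ge0 h.
  have /andP[t0 _] := h; apply: mulr_ge0; last exact: exprn_ge0.
  by apply: mulr_ge0 => //; apply: mulr_ge0.
have n1 : 0 < n.+1%:R :> R by [].
rewrite ler_pdivrMr //.
have AD : cosmom (0:R) n.+2 <= cosmom x n.+2.
  apply: Ihalfpi_le => // t h; rewrite ler_wpM2r // ?exprn_ge0 ?cos_halfpi_ge0 //.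
  by apply: le_trans (expC_ge2 x t); rewrite /expC mulr0 mul0r oppr0 expR0; lra.
(* The Wallis recurrence, which is [cosmom_rec] at x = 0. *)
have rec : cosmom (0:R) n = cosmom (0:R) n.+2 + cosmom (0:R) n.+2 / n.+1%:R.
  have := cosmom_rec (0:R) n; rewrite mulr0 expr0n /= add0r -natr1 => e.
  have n2 : n.+1%:R + 1 != 0 :> R by rewrite gt_eqF // addr_gt0.
  have {}e : (n.+1%:R + 1) * cosmom (0:R) n.+2 = n.+1%:R * cosmom (0:R) n.
    by apply: (mulfI n2); rewrite mulrA -expr2 e mulrA.
  by apply: (mulfI (lt0r_neq0 n1)); rewrite -e; field; rewrite gt_eqF.
apply: (@le_trans _ _ (8 * x * expR (pi * x) * (cosmom (0:R) n + - 1 * cosmom (0:R) n.+2))).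
  rewrite -IhalfpiZ // -IhalfpiD; [|by cont..].
  rewrite -IhalfpiZ; last by cont.
  apply: Ihalfpi_le => //; first by cont.
  move=> t h; have /andP[S0 S1] := S t h; have c0 := cos_halfpi_ge0 h.
  have /andP[t0 _] := h.
  have C0 : expC 0 t = 2 by rewrite /expC mulr0 mul0r oppr0 expR0; lra.
  rewrite C0 !exprS.
  have cn : 0 <= cos t ^+ n by rewrite exprn_ge0.
  have tc := mulcos_le_sin h.
  have t2 : (t * cos t) ^+ 2 <= 1 - cos t ^+ 2.
    by rewrite -sin2cos2; apply: lerXn2r => //; rewrite nnegrE ?mulr_ge0 //; apply: le_trans tc; rewrite mulr_ge0.
  move: (expR (pi * x)) (expR_ge0 (pi * x)) S1 => E E0 S1.
  move: (cos t ^+ n) cn => cn cn0; move: (cos t) c0 tc t2 => c c0 tc t2.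
  have K0 : 0 <= 8 * x * E * cn by rewrite !mulr_ge0 // ltW.
  apply: (@le_trans _ _ (2 * t * (4 * x * t * E) * (c * (c * cn)))).
    by rewrite ler_wpM2r ?mulr_ge0 // ler_wpM2l ?mulr_ge0.
  have -> : 2 * t * (4 * x * t * E) * (c * (c * cn)) = (8 * x * E * cn) * (t * c) ^+ 2 by ring.
  apply: (@le_trans _ _ ((8 * x * E * cn) * (1 - c ^+ 2))).
    by rewrite ler_wpM2l.
  have c2 : 0 <= 1 - c ^+ 2 by apply: le_trans t2; rewrite sqr_ge0.
  have := mulr_ge0 K0 c2; lra.
rewrite rec mulN1r [X in X - _]addrC addrK -[leRHS]mulrA ler_wpM2l //.
  by rewrite !mulr_ge0 ?expR_ge0 // ltW.
by rewrite [leRHS]mulrC ler_wpM2r // invr_ge0.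
Qed.

(* The recurrences make [dcosmom x n / cosmom x n] telescope along the partial fractions, from
   its value [pi coth (pi x) - 1/x] at [n = 0]; it tends to 0 because [cos ^+ n] concentrates
   at the origin. *)
Lemma coth_partial_fractions {R : realType} (x : R) : 0 < x ->
  \sum_(j < m) 2 * x / (x ^+ 2 + j.+1%:R ^+ 2) @[m --> \oo] --> pi * coth (pi * x) - x^-1.
Proof.
move=> x0; pose r m : R := dcosmom x m.*2 / cosmom x m.*2.
have step m : r m = r m.+1 + 2 * x / (x ^+ 2 + m.+1%:R ^+ 2).
  have A0 := cosmom_gt0 x m; have A1 := cosmom_gt0 x m.+1.
  have e1 := cosmom_rec x m.*2; have e2 := dcosmom_rec x m.*2.
  rewrite /r doubleS in A1 *.
  have p : 0 < (2 * x) ^+ 2 + m.*2.+2%:R ^+ 2 :> R by rewrite ltr_wpDl ?sqr_ge0 // exprn_gt0.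
  have pj : 0 < x ^+ 2 + m.+1%:R ^+ 2 :> R by rewrite ltr_wpDl ?sqr_ge0 // exprn_gt0.
  have q : 0 < m.*2.+2%:R * m.*2.+1%:R :> R by rewrite mulr_gt0.
  have -> : dcosmom x m.*2 / cosmom x m.*2 =
      (m.*2.+2%:R * m.*2.+1%:R * dcosmom x m.*2) / (m.*2.+2%:R * m.*2.+1%:R * cosmom x m.*2).
    by rewrite -mulf_div divff ?mul1r // gt_eqF.
  rewrite -e1 -e2.
  have -> : m.*2.+2%:R = 2 * m.+1%:R :> R by rewrite -doubleS -mul2n natrM.
  have -> : (2 * x) ^+ 2 + (2 * m.+1%:R) ^+ 2 = 4 * (x ^+ 2 + m.+1%:R ^+ 2) by ring.
  move: pj; move: (x ^+ 2 + _) => w pj.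
  by field; rewrite (gt_eqF pj) (gt_eqF A1).
have sumE m : \sum_(j < m) 2 * x / (x ^+ 2 + j.+1%:R ^+ 2) = r 0%N - r m.
  elim: m => [|m IH]; first by rewrite big_ord0 subrr.
  by rewrite big_ord_recr /= IH (step m); ring.
under eq_fun do rewrite sumE.
have -> : pi * coth (pi * x) - x^-1 = r 0%N - 0.
  rewrite subr0 /r double0 cosmom0 ?gt_eqF // dcosmom0 ?gt_eqF // /coth.
  have : 0 < expR (pi * x) - expR (- (pi * x)).
    rewrite subr_gt0 ltr_expR; have : 0 < pi * x by rewrite mulr_gt0 // pi_gt0.
    by lra.
  move: (pi : R) => p; move: (expR (p * x)) => a; move: (expR _) => b h.
  by field; rewrite !gt_eqF.
apply: cvgB; first exact: cvg_cst.
have H : (8 * x * expR (pi * x)) * n.+1%:R^-1 @[n --> \oo] --> (8 * x * expR (pi * x)) * 0.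
  by apply: cvgM; [exact: cvg_cst|exact: cvg_harmonic].
rewrite mulr0 in H.
rewrite -(@cvg_shiftS _ r).
apply: (squeeze_cvgr _ (cvg_cst 0) H).
apply: nearW => n; have /andP[h1 h2] := dcosmom_bound n x0.
rewrite /r /= doubleS h1 /= (le_trans h2) //.
rewrite ler_wpM2l ?mulr_ge0 ?expR_ge0 ?(ltW x0) //.
by rewrite lef_pV2 ?posrE // ler_nat ltnS -addnn leq_addr.
Qed.

(* [+- i * spole mu2 j] are the poles of [k coth (sqrt mu2 k)]. *)
Definition spole {R : realType} (mu2 : R) (j : nat) : R := j.+1%:R * pi / Num.sqrt mu2.

Lemma spole_gt0 {R : realType} (mu2 : R) (j : nat) : 0 < mu2 -> 0 < spole mu2 j.
Proof. by move=> h; rewrite /spole divr_gt0 ?sqrtr_gt0 // mulr_gt0 // pi_gt0. Qed.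

Lemma symD_partial_fractions {R : realType} (mu2 k : R) : 0 < mu2 ->
  (Num.sqrt mu2)^-1 + 2 / Num.sqrt mu2 * \sum_(j < m) k ^+ 2 / (spole mu2 j ^+ 2 + k ^+ 2)
    @[m --> \oo] --> symD mu2 k.
Proof.
move=> mu0; rewrite /symD; set a := Num.sqrt mu2.
have a0 : 0 < a by rewrite sqrtr_gt0.
case: eqVneq => [->|k0].
  apply: cvg_near_cst; apply: nearW => m.
  by rewrite big1 ?mulr0 ?addr0 // => i _; rewrite expr0n mul0r.
have p0 := pi_gt0 R; have kn0 : 0 < `|k| by rewrite normr_gt0.
(* With x = a |k| / pi one has pi x = a |k| and x^2 + (j + 1)^2 = (a / pi)^2 (k^2 + s_j^2). *)
have x0 : 0 < a * `|k| / pi by rewrite divr_gt0 // mulr_gt0.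
have h := coth_partial_fractions x0.
have e0 : pi * (a * `|k| / pi) = a * `|k|.
  by rewrite mulrCA divff ?mulr1 // gt_eqF.
rewrite e0 in h.
have -> : `|k| * coth (a * `|k|) =
    a^-1 + `|k| / pi * (pi * coth (a * `|k|) - (a * `|k| / pi)^-1).
  by move: (coth _) (pi : R) p0 {e0 h x0} => c p p0; field; rewrite !gt_eqF.
apply: cvgD; first exact: cvg_cst.
rewrite (_ : (fun m => _) = fun m => `|k| / pi *
   \sum_(j < m) 2 * (a * `|k| / pi) / ((a * `|k| / pi) ^+ 2 + j.+1%:R ^+ 2)).
  by apply: cvgM => //; exact: cvg_cst.
apply/funext => m; rewrite !mulr_sumr; apply: eq_bigr => j _.
rewrite /spole -/a -[k ^+ 2](real_normK (num_real k)).
have : 0 < j.+1%:R :> R by [].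
move: (j.+1%:R) (pi : R) p0 {e0 h x0} => n p p0 n0.
have n1 : 0 < p ^+ 2 * n ^+ 2 by rewrite mulr_gt0 // exprn_gt0.
have n2 : 0 <= a ^+ 2 * `|k| ^+ 2 by rewrite mulr_ge0 // sqr_ge0.
field; rewrite !gt_eqF //=.
all: rewrite ?exprMn; nra.
Qed.

(** * The multiplier |D| coth(sqrt mu2 |D|) *)

Lemma Lint_sum {R : realType} (F : nat -> R -> R) m : (forall j, integr (F j)) ->
  integr (fun x => \sum_(j < m) F j x) /\
  Lint (fun x => \sum_(j < m) F j x) = \sum_(j < m) Lint (F j).
Proof.
move=> I; elim: m => [|m [IH1 IH2]].
  rewrite (_ : (fun x => _) = fun x => 0 * F 0%N x).
    by split; [exact: integrZ|rewrite LintZ // mul0r big_ord0].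
  by apply/funext => x; rewrite big_ord0 mul0r.
rewrite (_ : (fun x => _) = fun x => (\sum_(j < m) F j x) + F m x).
  by split; [exact: integrD|rewrite LintD // IH2 big_ord_recr].
by apply/funext => x; rewrite big_ord_recr.
Qed.

Lemma sum_sqrV_le {R : realType} m : \sum_(j < m) (j.+1%:R ^+ 2)^-1 <= 2 :> R.
Proof.
(* The correction makes the induction close, by 1/(n + 1)^2 <= 1/n - 1/(n + 1). *)
suff : \sum_(j < m.+1) (j.+1%:R ^+ 2)^-1 <= 2 - m.+1%:R^-1 :> R.
  rewrite big_ord_recr /= => h.
  have h1 : 0 <= (m.+1%:R ^+ 2)^-1 :> R by rewrite invr_ge0 sqr_ge0.
  have h2 : 0 <= m.+1%:R^-1 :> R by rewrite invr_ge0.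
  by apply: (le_trans (le_trans _ h)); [rewrite lerDl|rewrite gerBl].
elim: m => [|m IH].
  by rewrite big_ord1 expr1n; lra.
rewrite big_ord_recr /=.
have n0 : 0 < m.+1%:R :> R by [].
apply: (le_trans (lerD IH (lexx _))); rewrite -(natr1 m.+1).
move: (m.+1%:R : R) n0 => n n0.
rewrite -subr_ge0 (_ : _ - _ = (n * (n + 1) ^+ 2)^-1).
  by rewrite invr_ge0 mulr_ge0 ?sqr_ge0 // ltW.
by field; rewrite !gt_eqF // addr_gt0.
Qed.

Lemma spoleE {R : realType} (mu2 : R) j : spole mu2 j = j.+1%:R * spole mu2 0.
Proof. by rewrite /spole mul1r mulrA. Qed.

Lemma sum_spole_le {R : realType} (mu2 : R) m : 0 < mu2 ->
  \sum_(j < m) (spole mu2 j ^+ 2)^-1 <= 2 / spole mu2 0 ^+ 2.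
Proof.
move=> h; have s0 := spole_gt0 0 h.
under eq_bigr do rewrite spoleE exprMn invfM.
by rewrite -mulr_suml ler_wpM2r ?sum_sqrV_le // invr_ge0 sqr_ge0.
Qed.

Lemma Lint_exp_shift {R : realType} (s x : R) : 0 < s ->
  integr (fun y => expR (- (s * `|x - y|))) /\ Lint (fun y => expR (- (s * `|x - y|))) = 2 / s.
Proof.
move=> s0.
have [I E] := Lint_exp_cos 0 0 s0.
have e : (fun y => expR (- (s * `|y|)) * cos (0 * (y - 0))) = (fun y => expR (- (s * `|y|))).
  by apply/funext => y; rewrite mul0r cos0 mulr1.
rewrite e in I E.
have c : continuous (fun y : R => expR (- (s * `|y|))) by cont.
have [I1 E1] := Lint_affine (- x) ltr01 c I.
have e1 : (fun y => expR (- (s * `|- x + 1 * y|))) = (fun y => expR (- (s * `|x - y|))).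
  by apply/funext => y; rewrite mul1r addrC distrC.
rewrite e1 mul1r in I1 E1.
split=> //; rewrite -E1 E mulr0 cos0; field.
by rewrite gt_eqF // mulr_gt0.
Qed.

(** Half of the decay of the kernel carries the exponential weight from y to x, the other half is
    integrated. The factor s^(-2) is kept because it is summable over the poles. *)
Lemma expconv_bound {R : realType} (K M sg s : R) (f : R -> R) : continuous f -> csupp K f ->
  (forall x, `|f x| <= M) -> 0 < sg -> 2 * sg <= s ->
  forall x, `|expconv s f x| <= 2 * M * expR (sg * K) / s ^+ 2 * expR (- (sg * `|x|)).
Proof.
move=> cf sf fM sg0 sgs x.
have s0 : 0 < s by lra.
have M0 : 0 <= M by apply: le_trans (fM 0).
have s2 : 0 < s / 2 by lra.
have [I2 E2] := Lint_exp_shift x s2.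
rewrite /expconv normrM ger0_norm; last by rewrite invr_ge0 mulr_ge0 // ltW.
have -> : 2 * M * expR (sg * K) / s ^+ 2 * expR (- (sg * `|x|)) =
    (2 * s)^-1 * (M * expR (sg * K) * expR (- (sg * `|x|)) * (2 / (s / 2))).
  by field; rewrite gt_eqF.
apply: ler_wpM2l; first by rewrite invr_ge0 mulr_ge0 // ltW.
rewrite -E2 -LintZ //; apply: Lint_norm_le.
- exact: (integr_expconv s x cf sf).
- exact: integrZ.
move=> y; rewrite normrM (ger0_norm (expR_ge0 _)).
apply: (le_trans (ler_wpM2r (expR_ge0 _) (csupp_exp_bound sf (ltW sg0) fM y))).
rewrite -!mulrA; do 2 (apply: ler_wpM2l; rewrite ?expR_ge0 //).
rewrite -!expRD ler_expR.
have h : `|x| <= `|y| + `|x - y| by have := ler_normD (x - y) y; rewrite subrK addrC.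
have := normr_ge0 (x - y); nra.
Qed.

(** Needed below for the measurability of [expconv s f] in its argument, which Fubini supplies along
    with integrability. *)
Lemma integr_expconv_total {R : realType} (K s : R) (f : R -> R) : continuous f -> csupp K f ->
  0 < s -> integr (expconv s f).
Proof.
move=> cf sf s0; apply: integrZ.
pose F := fun z : R * R => f z.2 * expR (- (s * `|z.1 - z.2|)).
have mF : measurable_fun setT F.
  apply: measurable_funM; first by apply: meas_snd; exact: continuous_meas.
  apply: (@measurableT_comp _ _ _ _ _ _ (fun x : R => expR (- (s * `|x|)))).
    by apply: continuous_meas; cont.
  by apply: measurable_funB; [exact: measurable_fst|exact: measurable_snd].
have Iq : integr (fun y => `|f y| * expR (s * `|y|)).
  apply: (@integr_csupp _ K); first by cont.
  by move=> y h; rewrite sf // normr0 mul0r.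
have bF x y : `|F (x, y)| <= expR (- (s * `|x|)) * (`|f y| * expR (s * `|y|)).
  rewrite /F /= normrM (ger0_norm (expR_ge0 _)) [leRHS]mulrCA ler_wpM2l //.
  rewrite -expRD ler_expR.
  have h : `|x| <= `|y| + `|x - y| by have := ler_normD (x - y) y; rewrite subrK addrC.
  nra.
by have [] := Lint_fubini mF (integr_exp s0) Iq bF.
Qed.

(* The first [m] terms of the partial fraction expansion of [|D| coth (sqrt mu2 |D|)]. *)
Definition Dpart {R : realType} (mu2 : R) (m : nat) (f : R -> R) (x : R) : R :=
  (Num.sqrt mu2)^-1 * f x +
  2 / Num.sqrt mu2 * \sum_(j < m) (f x - spole mu2 j ^+ 2 * expconv (spole mu2 j) f x).

Section symD.
Variables (R : realType) (mu2 K : R) (D : nat -> R -> R).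
Hypothesis mu0 : 0 < mu2.
Hypothesis derD : forall n (x : R), is_derive x 1 (D n) (D n.+1 x).
Hypothesis suppD0 : csupp K (D 0%N).

Let contD n : continuous (D n). Proof. exact: is_derive_continuous (derD n). Qed.
Let suppD n : csupp K (D n).
Proof. by elim: n => // n IH; exact: csupp_derive (derD n) IH. Qed.
Let a0 : 0 < Num.sqrt mu2. Proof. by rewrite sqrtr_gt0. Qed.
Let sp0 j : 0 < spole mu2 j. Proof. exact: spole_gt0. Qed.

Let Phi n (x k : R) : R := Lint (fun y => D n y * cos (k * (x - y))).

Let Phi2 n (x k : R) : Phi n.+2 x k = - (k ^+ 2 * Phi n x k).
Proof. exact: (Lint_cos_derive2 (derD n) (derD n.+1) (@contD n.+2) (@suppD n)). Qed.

Let Phi_bound n : exists2 C : R, 0 <= C & forall x k : R, `|Phi n x k| <= C.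
Proof.
have I := integr_csupp (@contD n) (@suppD n).
exists (Lint (fun y => `|D n y|)); first by apply: Lint_ge0.
move=> x k; apply: Lint_norm_le; last first.
- by move=> y; rewrite normrM ler_piMr // abs_cos_le1.
- exact: integr_norm.
- have c := @contD n; apply: (@integr_csupp _ K); [by cont|exact: (csupp_mul _ (@suppD n))].
Qed.

(** Writes [Phi] as a combination of resolvent symbols times transforms of test functions, whose
    integrability in k is known. *)
Let PhiE n x k : Phi n x k = (1 ^+ 2 + k ^+ 2)^-1 * Phi n x k - (1 ^+ 2 + k ^+ 2)^-1 * Phi n.+2 x k.
Proof.
rewrite Phi2 expr1n; move: (Phi _ _ _) => L; have := sqD1_gt0 k => h.
by field; rewrite gt_eqF.
Qed.

Let integr_Phi n x : integr (Phi n x).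
Proof.
rewrite (funext (PhiE n x)); apply: integrB.
  exact: (fmult_resolvent ltr01 (@contD n) (@suppD n) x).1.
exact: (fmult_resolvent ltr01 (@contD n.+2) (@suppD n.+2) x).1.
Qed.

Let pm m (k : R) : R := (Num.sqrt mu2)^-1 + 2 / Num.sqrt mu2 * \sum_(j < m) k ^+ 2 / (spole mu2 j ^+ 2 + k ^+ 2).

Let pmE m x k : pm m k * Phi 0 x k = (Num.sqrt mu2)^-1 * Phi 0 x k +
   2 / Num.sqrt mu2 * \sum_(j < m) (- 1) * ((spole mu2 j ^+ 2 + k ^+ 2)^-1 * Phi 2 x k).
Proof.
rewrite /pm mulrDl -[X in _ + X]mulrA mulr_suml; congr (_ + _ * _); apply: eq_bigr => j _.
by rewrite Phi2; ring.
Qed.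

Let integr_pm x j : integr (fun k => (- 1) * ((spole mu2 j ^+ 2 + k ^+ 2)^-1 * Phi 2 x k)).
Proof. apply: integrZ; exact: (fmult_resolvent (sp0 j) (@contD 2) (@suppD 2) x).1. Qed.

Let fmult_pm m x : integr (fun k => pm m k * Phi 0 x k) /\ fmult (pm m) (D 0%N) x = Dpart mu2 m (D 0%N) x.
Proof.
have [I1 I2] := Lint_sum m (integr_pm x).
have E : (fun k => pm m k * Phi 0 x k) = _ := funext (pmE m x).
rewrite E; split.
  by apply: integrD; apply: integrZ => //; exact: integr_Phi.
rewrite /fmult E LintD; [|exact: integrZ..].
rewrite !LintZ // mulrDr /Dpart; congr (_ + _).
  rewrite -(fmult1 (derD 0) (derD 1) (@contD 2) suppD0 x) /fmult mulrCA; congr (_ * (_ * _)).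
  by apply: eq_Lint => k; rewrite mul1r.
rewrite I2 mulrCA; congr (_ * _); rewrite mulr_sumr; apply: eq_bigr => j _.
have [J1 J2] := fmult_resolvent (sp0 j) (@contD 2) (@suppD 2) x.
rewrite LintZ // mulrCA -/(fmult _ _ _) J2 (expconv_derive2 (sp0 j) (derD 0) (derD 1) (@contD 2) suppD0); ring.
Qed.

(** Each term satisfies k^2 / (s_j^2 + k^2) <= k^2 / s_j^2, which is summable in j. Quadratic growth
    exceeds the true order |k|, but the bound is uniform in [m] and transforms of test functions
    absorb it. *)
Let pm_bound : exists2 C : R, 0 <= C & forall m (k : R), `|pm m k| <= (Num.sqrt mu2)^-1 + C * k ^+ 2.
Proof.
exists (2 / Num.sqrt mu2 * (2 / spole mu2 0 ^+ 2)).
  by rewrite !mulr_ge0 // invr_ge0 ?sqr_ge0 // ltW.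
move=> m k; have q j : 0 <= k ^+ 2 / (spole mu2 j ^+ 2 + k ^+ 2).
  by rewrite divr_ge0 ?sqr_ge0 // addr_ge0 ?sqr_ge0.
rewrite ger0_norm; last first.
  by rewrite addr_ge0 // ?invr_ge0 ?(ltW a0) // mulr_ge0 ?sumr_ge0 // divr_ge0 // ltW.
rewrite lerD2l -[leRHS]mulrA ler_wpM2l ?divr_ge0 ?(ltW a0) //.
apply: (@le_trans _ _ (\sum_(j < m) (spole mu2 j ^+ 2)^-1 * k ^+ 2)).
  apply: ler_sum => j _; rewrite mulrC ler_wpM2r ?sqr_ge0 //.
  by rewrite lef_pV2 ?posrE ?sqD_gt0 ?exprn_gt0 // lerDl sqr_ge0.
by rewrite -mulr_suml ler_wpM2r ?sqr_ge0 // sum_spole_le.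
Qed.

Lemma fmult_symD_cvg x : integr (fun k => symD mu2 k * Lint (fun y => D 0%N y * cos (k * (x - y)))) /\
  Dpart mu2 m (D 0%N) x @[m --> \oo] --> fmult (symD mu2) (D 0%N) x.
Proof.
have [C C0 bC] := pm_bound.
have [M0 M00 b0] := Phi_bound 0; have [M2 M20 b2] := Phi_bound 2; have [M4 M40 b4] := Phi_bound 4.
have [I L] : integr (fun k => symD mu2 k * Phi 0 x k) /\
    Lint (fun k => pm m k * Phi 0 x k) @[m --> \oo] --> Lint (fun k => symD mu2 k * Phi 0 x k).
  (* Multiplying the bound of [pm] by 1 + k^2 leaves powers of k up to the fourth, controlled by the
     transforms of the derivatives of order 0, 2 and 4. *)
  apply: (Lint_dct (g := fun k => ((Num.sqrt mu2)^-1 * (M0 + M2) + C * (M2 + M4)) * (1 + k ^+ 2)^-1)).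
  - by move=> m; exact: (integr_meas (fmult_pm m x).1).
  - by apply: integrZ; exact: integr_oneDsqrV.
  - move=> m k; rewrite ler_pdivlMr ?sqD1_gt0 // normrM.
    have k2 : 0 <= k ^+ 2 by rewrite sqr_ge0.
    have h0 := b0 x k; have h2 := b2 x k; have h4 := b4 x k.
    rewrite Phi2 normrN normrM (ger0_norm k2) in h2.
    rewrite !Phi2 mulrN opprK normrM (ger0_norm k2) normrM (ger0_norm k2) in h4.
    have ai : 0 <= (Num.sqrt mu2)^-1 by rewrite invr_ge0 ltW.
    have := bC m k; move: (`|pm m k|) (normr_ge0 (pm m k)) => P P0 bP.
    move: (`|Phi 0 x k|) (normr_ge0 (Phi 0 x k)) h0 h2 h4 => F F0 h0 h2 h4.
    apply: (@le_trans _ _ (((Num.sqrt mu2)^-1 + C * k ^+ 2) * F * (1 + k ^+ 2))).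
      by rewrite ler_wpM2r ?(ltW (sqD1_gt0 _)) // ler_wpM2r.
    move: ((Num.sqrt mu2)^-1) ai => A A0.
    have -> : (A + C * k ^+ 2) * F * (1 + k ^+ 2) =
      A * (F + k ^+ 2 * F) + C * (k ^+ 2 * F + k ^+ 2 * (k ^+ 2 * F)) by ring.
    by apply: lerD; apply: ler_wpM2l => //; apply: lerD.
  - by move=> k; apply: cvgM; [exact: symD_partial_fractions|exact: cvg_cst].
split=> //.
under eq_fun do rewrite -(fmult_pm _ _).2.
by apply: cvgM => //; exact: cvg_cst.
Qed.

Lemma fmult_affine_symD (p q x : R) :
  fmult (fun k => p + q * symD mu2 k) (D 0%N) x = p * D 0%N x + q * fmult (symD mu2) (D 0%N) x.
Proof.
have [I _] := fmult_symD_cvg x.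
have J := integr_Phi 0 x.
rewrite -[in p * _](fmult1 (derD 0) (derD 1) (@contD 2) suppD0 x) /fmult.
rewrite mulrCA (mulrCA q) -mulrDr; congr (_ * _).
under [X in p * X]eq_Lint do rewrite mul1r.
rewrite -LintZ // -LintZ // -LintD; [|exact: integrZ..].
by apply: eq_Lint => k; ring.
Qed.

(** Since [w] is only bounded, the partial sums need an integrable majorant in x. It comes from
    rewriting each term as minus the resolvent of the second derivative, which decays exponentially
    at the fixed rate s_0 / 2 with a coefficient summable in j. *)
Lemma Lint_fmult_symD (w : R -> R) (Mw : R) : continuous w -> (forall x, `|w x| <= Mw) ->
  integr (fun x => w x * fmult (symD mu2) (D 0%N) x) /\
  Lint (fun x => w x * Dpart mu2 m (D 0%N) x) @[m --> \oo] -->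
    Lint (fun x => w x * fmult (symD mu2) (D 0%N) x).
Proof.
move=> cw bw.
have Mw0 : 0 <= Mw by apply: le_trans (bw 0).
have [M2 M20 b2] := csupp_bounded (@contD 2) (@suppD 2).
pose sg := spole mu2 0 / 2.
have sg0 : 0 < sg by rewrite divr_gt0.
have E j x : D 0%N x - spole mu2 j ^+ 2 * expconv (spole mu2 j) (D 0%N) x = - expconv (spole mu2 j) (D 2) x.
  by rewrite (expconv_derive2 (sp0 j) (derD 0) (derD 1) (@contD 2) suppD0); ring.
have sgs j : 2 * sg <= spole mu2 j.
  rewrite /sg [leRHS]spoleE; have j1 : 1 <= j.+1%:R :> R by rewrite ler1n.
  by have := sp0 0; nra.
have b := expconv_bound (@contD 2) (@suppD 2) b2 sg0 (sgs _).
pose C := 2 * M2 * expR (sg * K).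
have C0 : 0 <= C by rewrite !mulr_ge0 // expR_ge0.
have I0 := integr_csupp (@contD 0) (@suppD 0).
apply: (Lint_dct (g := fun x => Mw * ((Num.sqrt mu2)^-1 * `|D 0%N x| +
   2 / Num.sqrt mu2 * (C * (2 / spole mu2 0 ^+ 2)) * expR (- (sg * `|x|))))).
- move=> m; apply: measurable_funM; first exact: continuous_meas.
  apply: integr_meas; apply: integrD; first exact: integrZ.
  apply: integrZ; apply: (Lint_sum m (F := fun j x => D 0%N x - spole mu2 j ^+ 2 * expconv (spole mu2 j) (D 0%N) x) _).1.
  move=> j; apply: integrB => //; apply: integrZ.
  exact: (integr_expconv_total (@contD 0) (@suppD 0) (sp0 j)).
- apply: integrZ; apply: integrD; first by apply: integrZ; exact: integr_norm.
  by apply: integrZ; exact: integr_exp.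
- move=> m x; rewrite normrM; apply: ler_pM => //.
  apply: (le_trans (ler_normD _ _)); apply: lerD.
    by rewrite normrM ger0_norm // invr_ge0 ltW.
  rewrite normrM ger0_norm; last by rewrite divr_ge0 // ltW.
  rewrite -[leRHS]mulrA; apply: ler_wpM2l; first by rewrite divr_ge0 // ltW.
  apply: (le_trans (ler_norm_sum _ _ _)).
  apply: (@le_trans _ _ (\sum_(j < m) (C * expR (- (sg * `|x|))) * (spole mu2 j ^+ 2)^-1)).
    apply: ler_sum => j _; rewrite E normrN.
    by apply: (le_trans (b j x)); rewrite -/C mulrAC.
  rewrite -mulr_sumr -[leRHS]mulrA [X in _ <= _ * X]mulrC mulrA; apply: ler_wpM2l.
    by rewrite mulr_ge0 // expR_ge0.
  exact: sum_spole_le.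
- move=> x; apply: cvgM; first exact: cvg_cst.
  exact: (fmult_symD_cvg x).2.
Qed.

End symD.

(** * A smooth bump function *)

(** Used at the edge points |x| = 1 of the bump, where the two formulas meet. *)
Lemma is_derive_quad0 {R : realType} (f : R -> R) (x C : R) :
  (forall y, `|f y - f x| <= C * (y - x) ^+ 2) -> is_derive x 1 f 0.
Proof.
move=> b.
have C0 : 0 <= C.
  have := b (x + 1); rewrite (_ : x + 1 - x = 1); last by ring.
  by rewrite expr1n mulr1; apply: le_trans.
have H : h^-1 *: (f (h *: 1 + x) - f x) @[h --> 0^'] --> (0 : R).
  apply/cvgr0Pnorm_lt => e e0; near=> h.
  have h0 : h != 0 by near: h; exact: nbhs_dnbhs_neq.
  have := b (h *: 1 + x); rewrite addrK /GRing.scale /= mulr1 => bh.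
  rewrite normrM normfV ltr_pdivrMl ?normr_gt0 //.
  apply: (le_lt_trans bh); rewrite -(real_normK (num_real h)) expr2 mulrCA ltr_pM2l ?normr_gt0 //.
  apply: (@le_lt_trans _ _ ((C + 1) * `|h|)); first by rewrite ler_wpM2r // lerDl.
  rewrite -ltr_pdivlMl; last by rewrite ltr_wpDl.
  near: h; apply: dnbhs0_lt; rewrite mulr_gt0 // invr_gt0 ltr_wpDl //.
apply: DeriveDef; first by apply/cvg_ex; exists 0.
exact: cvg_lim H.
Unshelve. all: by end_near. Qed.

Lemma der_inv {R : realType} (f : R -> R) (x a : R) : f x != 0 -> is_derive x 1 f a ->
  is_derive x 1 (fun y => (f y)^-1) (- (f x)^-1 ^+ 2 * a).
Proof.
move=> n A; apply: (is_derive_eq (is_deriveV n A)).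
by rewrite /GRing.scale /= exprVn.
Qed.

Lemma expR_ge_pow {R : realType} (t : R) n : 0 <= t -> t ^+ n.+1 * expR (- t) <= n.+1`!%:R.
Proof.
move=> t0; rewrite expRN ler_pdivrMr ?expR_gt0 //.
have := expR_ge1Dxn n t0; have : 0 < n.+1`!%:R :> R by rewrite ltr0n fact_gt0.
move: (n.+1`!%:R) => F F0 h.
rewrite -ler_pdivrMl // mulrC; apply: le_trans h; rewrite lerDr //.
Qed.

(** With u = 1/(1 - x^2), the functions p(x) u^(k+1) e^(-u) form a family closed under
    differentiation, so smoothness follows by iterating one derivative computation. *)
Definition bumpfun {R : realType} (p : {poly R}) (k : nat) (x : R) : R :=
  if `|x| < 1 then p.[x] * (1 - x ^+ 2)^-1 ^+ k.+1 * expR (- (1 - x ^+ 2)^-1) else 0.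

(** Since u' = 2 x u^2, differentiating p u^(k+1) e^(-u) and factoring out u^(k+3) leaves this
    polynomial; hence the index goes from k to k + 2. *)
Definition bumppoly {R : realType} (p : {poly R}) (k : nat) : {poly R} :=
  p^`() * (1 - 'X^2) ^+ 2 + (2 * k.+1%:R) *: ('X * (1 - 'X^2) * p) - 2 *: ('X * p).

Lemma bumppolyE {R : realType} (p : {poly R}) (k : nat) (x : R) : (bumppoly p k).[x] =
  p^`().[x] * (1 - x ^+ 2) ^+ 2 + 2 * k.+1%:R * (x * (1 - x ^+ 2) * p.[x]) - 2 * (x * p.[x]).
Proof. by rewrite /bumppoly !hornerE. Qed.

Lemma bumpfun_bound {R : realType} (p : {poly R}) (k : nat) :
  exists2 C : R, 0 <= C & forall x, `|bumpfun p k x| <= C * (1 - x ^+ 2) ^+ 2.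
Proof.
have cn : {within `[-1, 1 : R], continuous (fun x => `|p.[x]|)}.
  by apply: continuous_subspaceT; apply: cont_norm; exact: continuous_horner.
have [|c _ h] := EVT_max _ cn; first by lra.
(* u^(k+3) e^(-u) <= (k+3)!, with k + 1 powers from the function and two from (1 - x^2)^2. *)
exists (`|p.[c]| * k.+3`!%:R); first by rewrite mulr_ge0.
move=> x; rewrite /bumpfun; case: ifP => [x1|_]; last first.
  by rewrite normr0; apply: mulr_ge0; [exact: mulr_ge0|exact: sqr_ge0].
have u0 : 0 < 1 - x ^+ 2.
  by rewrite subr_gt0 -(real_normK (num_real x)) expr_lt1.
move: (1 - x ^+ 2) u0 => u u0.
have v0 : 0 < u^-1 by rewrite invr_gt0.
have w0 : 0 <= u^-1 ^+ k.+1 * expR (- u^-1).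
  by rewrite mulr_ge0 ?expR_ge0 // exprn_ge0 // ltW.
rewrite -mulrA normrM (ger0_norm w0) -mulrA; apply: ler_pM => //.
- by apply: h; rewrite in_itv /= -ler_norml ltW.
rewrite -ler_pdivrMr ?exprn_gt0 //.
have := expR_ge_pow k.+2 (ltW v0); apply: le_trans.
by rewrite !exprS expr0 mulr1 invfM; lra.
Qed.

Lemma is_derive_bumpfun {R : realType} (p : {poly R}) (k : nat) (x : R) :
  is_derive x 1 (bumpfun p k) (bumpfun (bumppoly p k) k.+2 x).
Proof.
have [C C0 b] := bumpfun_bound p k.
have cn : continuous (fun y : R => `|y|) by cont.
have [x1|x1|x1] := ltgtP `|x| 1.
- have u0 : 1 - x ^+ 2 != 0.
    by rewrite gt_eqF // subr_gt0 -(real_normK (num_real x)) expr_lt1.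
  pose F y : R := p.[y] * (1 - y ^+ 2)^-1 ^+ k.+1 * expR (- (1 - y ^+ 2)^-1).
  apply: (@near_eq_is_derive _ _ _ F).
    near=> y; rewrite /bumpfun ifT //; near: y.
    exact: (cvgr_lt _ (cn x) _ x1).
  have dp : is_derive x 1 (horner p) p^`().[x].
    apply: DeriveDef; first exact: derivable_horner.
    by rewrite derivE derive1E.
  have du : is_derive x 1 (fun y => (1 - y ^+ 2)^-1) (- (1 - x ^+ 2)^-1 ^+ 2 * (- (2 * x))).
    notypeclasses refine (@der_inv _ (fun y => 1 - y ^+ 2) _ _ _ _) => //.
    by deriv; rewrite expr1; ring.
  rewrite /F; eapply is_derive_eq.
    notypeclasses refine (der_mul (der_mul dp (der_pow _ du)) (der_expR (der_opp du))).
  rewrite /bumpfun x1 bumppolyE.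
  move: (expR _) (mulfV u0) => E.
  move: (1 - x ^+ 2) (p.[x]) (p^`().[x]) {du dp u0 F} => u q q'.
  move: (u^-1) => v uv; rewrite [v ^+ k.+1]exprS -addn3 [v ^+ (k + 3)]exprD.
  move: (v ^+ k) => W.
  transitivity (E * W * (q' * v * (u * v) ^+ 2 + 2 * k.+1%:R * x * q * v ^+ 2 * (u * v) - 2 * x * q * v ^+ 3)).
    by rewrite uv; ring.
  by ring.
- rewrite /bumpfun ifF; last by apply/negbTE; rewrite -leNgt ltW.
  apply: (@near_eq_is_derive _ _ _ (cst 0)).
    near=> y; rewrite /bumpfun ifF //; apply/negbTE; rewrite -leNgt ltW //; near: y.
    exact: (cvgr_gt _ (cn x) _ x1).
- have z q j : bumpfun q j x = 0 by rewrite /bumpfun x1 ltxx.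
  rewrite z.
  apply: (@is_derive_quad0 _ _ _ (C * 4)) => y.
  rewrite z subr0 /bumpfun; case: ifP => y1; last first.
    by rewrite normr0; apply: mulr_ge0; [exact: mulr_ge0|exact: sqr_ge0].
  have := b y; rewrite /bumpfun y1 => /le_trans -> //.
  rewrite -mulrA ler_wpM2l //.
  have x2 : x = 1 \/ x = -1.
    by have := x1; case: ger0P => _ h; [left|right]; lra.
  move: y1; rewrite ltr_norml => /andP[y1 y2].
  rewrite -subr_ge0; case: x2 => ->.
    have -> : 4 * (y - 1) ^+ 2 - (1 - y ^+ 2) ^+ 2 = (y - 1) ^+ 2 * ((1 - y) * (3 + y)) by ring.
    by rewrite mulr_ge0 ?sqr_ge0 // mulr_ge0; lra.
  have -> : 4 * (y - (-1)) ^+ 2 - (1 - y ^+ 2) ^+ 2 = (y + 1) ^+ 2 * ((1 + y) * (3 - y)) by ring.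
  by rewrite mulr_ge0 ?sqr_ge0 // mulr_ge0; lra.
Unshelve. all: by end_near. Qed.

(** Polynomial and index of the n-th derivative of the bump (1 - x^2)^-1 exp(- (1 - x^2)^-1). *)
Fixpoint bumpseq {R : realType} (n : nat) : {poly R} * nat :=
  if n is m.+1 then (bumppoly (@bumpseq R m).1 (@bumpseq R m).2, (@bumpseq R m).2.+2) else (1, 0%N).

Lemma exists_bump {R : realType} : exists D : nat -> R -> R,
  [/\ forall n (x : R), is_derive x 1 (D n) (D n.+1 x), forall x, 0 <= D 0%N x,
      csupp 1 (D 0%N) & Lint (D 0%N) = 1].
Proof.
pose B n := bumpfun (@bumpseq R n).1 (@bumpseq R n).2.
have dB n (x : R) : is_derive x 1 (B n) (B n.+1 x) by exact: is_derive_bumpfun.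
have cB : continuous (B 0%N) by exact: is_derive_continuous (dB 0%N).
have sB : csupp 1 (B 0%N).
  by move=> x x1; rewrite /B /bumpfun ifF //; apply/negbTE; rewrite -leNgt ltW.
have B0 x : 0 <= B 0%N x.
  rewrite /B /bumpfun /=; case: ifP => // x1; rewrite hornerC mul1r mulr_ge0 ?expR_ge0 //.
  rewrite exprn_ge0 // invr_ge0 subr_ge0 -(real_normK (num_real x)) expr_le1 // ltW //.
have I := integr_csupp cB sB.
(* Positivity of the total mass: on [-1/2, 1/2] one has 1 <= 1/(1 - x^2) <= 4/3, so the bump is at
   least e^(-4/3) there. *)
pose A : set R := [set` `[- 2^-1, 2^-1]].
pose c : R := expR (- (4 / 3)).
have Bc x : ((fun=> c) \_ A) x <= B 0%N x.
  rewrite patchE; case: ifP => // /set_mem; rewrite /A /= in_itv /= => h.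
  have x1 : `|x| < 1 by rewrite ltr_norml; lra.
  have x2 : x ^+ 2 <= 4^-1 by nra.
  rewrite /B /bumpfun x1 /= hornerC mul1r expr1.
  have u0 : 0 < 1 - x ^+ 2 by lra.
  have v1 : (1 - x ^+ 2)^-1 <= 4 / 3 by rewrite invf_ple ?posrE //; lra.
  have v2 : 1 <= (1 - x ^+ 2)^-1 by rewrite invf_ge1 //; have := sqr_ge0 x; lra.
  rewrite -[leLHS]mul1r; apply: ler_pM; rewrite ?expR_ge0 //.
  by rewrite ler_expR lerN2.
have IA : integr ((fun=> c) \_ A).
  apply: (integr_le (g := B 0%N)) => //.
    by apply/(measurable_restrictT _ _).1 => //; exact: measurable_itv.
  move=> x; rewrite ger0_norm // patchE; case: ifP => // _; exact: expR_ge0.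
have Z0 : 0 < Lint (B 0%N).
  apply: (lt_le_trans _ (Lint_le IA I Bc)).
  rewrite /Lint -Rintegral_mkcond Rintegral_cst; last exact: measurable_itv.
  have := lebesgue_measure_itv `[(- 2^-1 : R), 2^-1].
  rewrite /= lte_fin ifT; last by lra.
  move=> mA; rewrite [lebesgue_measure A]mA /= mulr_gt0 ?expR_gt0 //; lra.
exists (fun n x => (Lint (B 0%N))^-1 * B n x); split.
- move=> n x; eapply is_derive_eq; first notypeclasses refine (der_mul (der_cst (Lint (B 0%N))^-1 x) (dB n x)).
  by rewrite mul0r add0r.
- by move=> x; rewrite mulr_ge0 // invr_ge0 ltW.
- by move=> x h; rewrite sB // mulr0.
- by rewrite LintZ // mulVf // gt_eqF.
Qed.

(** * Decay at infinity of continuous H^1 functions *)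

(** f((y - x0)/d) with the power of 1/d that accompanies an n-th derivative: n = 0 keeps heights, n
    = 1 keeps the integral. The argument is written in the affine form expected by [Lint_affine]. *)
Definition rescale {R : realType} (d x0 : R) (n : nat) (f : R -> R) (y : R) : R :=
  d^-1 ^+ n * f (- (x0 / d) + d^-1 * y).

Lemma is_derive_rescale {R : realType} (d x0 : R) n (f df : R -> R) :
  (forall x : R, is_derive x 1 f (df x)) ->
  forall x : R, is_derive x 1 (rescale d x0 n f) (rescale d x0 n.+1 df x).
Proof.
move=> h x; rewrite /rescale; deriv.
  notypeclasses refine (@der_comp _ f (fun y => - (x0 / d) + d^-1 * y) _ _ _ (h _) _).
  by repeat deriv1.
by rewrite exprS; ring.
Qed.

Lemma csupp_rescale {R : realType} (d x0 : R) n (f : R -> R) : 0 < d -> csupp 1 f ->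
  forall y, d < `|y - x0| -> rescale d x0 n f y = 0.
Proof.
move=> d0 sf y h; rewrite /rescale sf ?mulr0 //.
rewrite (_ : _ + _ = d^-1 * (y - x0)); last by ring.
by rewrite normrM gtr0_norm ?invr_gt0 // mulrC ltr_pdivlMr // mul1r.
Qed.

Lemma csupp_rescale_total {R : realType} (d x0 : R) n (f : R -> R) : 0 < d -> csupp 1 f ->
  csupp (d + `|x0|) (rescale d x0 n f).
Proof.
move=> d0 sf y h; apply: csupp_rescale => //.
by have := ler_normD (y - x0) x0; rewrite subrK; lra.
Qed.

Lemma continuous_rescale {R : realType} (d x0 : R) n (f : R -> R) : continuous f ->
  continuous (rescale d x0 n f).
Proof. by move=> cf; rewrite (_ : rescale d x0 n f = fun y => rescale d x0 n f y) // /rescale; cont. Qed.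

Lemma Lint_rescale {R : realType} (d x0 : R) (f : R -> R) : 0 < d -> continuous f -> integr f ->
  Lint (rescale d x0 1 f) = Lint f.
Proof.
move=> d0 cf If; have d1 : 0 < d^-1 by rewrite invr_gt0.
have [I ->] := Lint_affine (- (x0 / d)) d1 cf If.
by rewrite -LintZ //; apply: eq_Lint => y; rewrite /rescale expr1.
Qed.

Lemma mollify_close {R : realType} (f r : R -> R) (d x0 e : R) : continuous f -> continuous r ->
  0 < d -> csupp 1 r -> (forall x, 0 <= r x) -> Lint r = 1 ->
  (forall y, `|y - x0| <= d -> `|f y - f x0| <= e) ->
  integr (fun y => f y * rescale d x0 1 r y) /\
  `|Lint (fun y => f y * rescale d x0 1 r y) - f x0| <= e.
Proof.
move=> cf cr d0 sr r0 r1 h.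
have cR := @continuous_rescale _ d x0 1 _ cr.
have sR := @csupp_rescale_total _ d x0 1 _ d0 sr.
have IR := integr_csupp cR sR.
have I : integr (fun y => f y * rescale d x0 1 r y).
  apply: (@integr_csupp _ (d + `|x0|)); first by cont.
  by move=> y hy; rewrite sR // mulr0.
split=> //.
have L1 := Lint_rescale x0 d0 cr (integr_csupp cr sr); rewrite r1 in L1.
have -> : f x0 = Lint (fun y => f x0 * rescale d x0 1 r y) by rewrite LintZ // L1 mulr1.
rewrite -LintB //; last exact: integrZ.
have -> : e = Lint (fun y => e * rescale d x0 1 r y) by rewrite LintZ // L1 mulr1.
apply: Lint_norm_le; [by apply: integrB => //; exact: integrZ|exact: integrZ|].
move=> y; rewrite -mulrBl normrM.
have R0 : 0 <= rescale d x0 1 r y by rewrite /rescale expr1 mulr_ge0 // invr_ge0 ltW.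
rewrite (ger0_norm R0).
have [yd|yd] := leP `|y - x0| d; first by rewrite ler_wpM2r // h.
by rewrite (csupp_rescale (x0 := x0)) // !mulr0.
Qed.

(** The difference of two rescaled translates of this step is a test function whose derivative is a
    difference of two bumps: testing the weak derivative with it compares the values of a function
    at two points. *)
Lemma exists_step {R : realType} (r : R -> R) : continuous r -> csupp 1 r ->
  (forall x, 0 <= r x) -> Lint r = 1 -> exists T : R -> R,
  [/\ forall x : R, is_derive x 1 T (r x), forall x, x < -1 -> T x = 0,
      forall x, 1 < x -> T x = 1 & forall x, 0 <= T x <= 1].
Proof.
move=> cr sr r0 r1; have I := integr_csupp cr sr.
pose T x := Rintegral (@lebesgue_measure R) [set` `]-oo, x]] r.
have TE x : T x = Lint (r \_ [set` `]-oo, x]]) by rewrite /T Rintegral_mkcond.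
have IT x : integr (r \_ [set` `]-oo, x]]).
  apply: (integr_le (g := r)) => //.
    apply/(measurable_restrictT _ _).1; first exact: measurable_itv.
    by apply: measurable_funTS; exact: continuous_meas.
  by move=> y; rewrite patchE; case: ifP => _; rewrite ?normr0 // ger0_norm.
exists T; split.
- move=> x.
  have x1 : x < x + 1 by lra.
  have Iu : (@lebesgue_measure R).-integrable [set` Interval -oo%O (BRight (x + 1))] (EFin \o r).
    by apply: integrableS I => //; exact: measurable_itv.
  have [d e] : derivable T x 1 /\ derive1 T x = r x.
    by apply: (continuous_FTC1 x1 Iu); [rewrite ltNyr|exact: cr].
  by apply: DeriveDef; [exact: d|rewrite -derive1E; exact: e].
- move=> x x1; rewrite TE; transitivity (Lint (fun y => 0 * r y)); last by rewrite LintZ // mul0r.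
  apply: eq_Lint => y.
  rewrite mul0r patchE; case: ifP => // /set_mem /=; rewrite in_itv /= => yx.
  by apply: sr; have := ler_norm (- y); rewrite normrN; lra.
- move=> x x1; rewrite TE -r1; apply: eq_Lint => y.
  rewrite patchE; case: ifP => // /negbT; rewrite notin_setE /= in_itv /= => /negP; rewrite -ltNge => yx.
  by apply/esym/sr; have := ler_norm y; lra.
- move=> x; rewrite TE; apply/andP; split.
    by apply: Lint_ge0 => y; rewrite patchE; case: ifP.
  by rewrite -r1; apply: Lint_le => // y; rewrite patchE; case: ifP.
Qed.

Lemma indic_itv {R : realType} (x L : R) : 0 <= L ->
  integr (\1_[set` `[x - L, x + L]] : R -> R) /\ Lint (\1_[set` `[x - L, x + L]] : R -> R) = 2 * L.
Proof.
move=> L0; split; first exact: integrable_indic_itv.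
rewrite /Lint /Rintegral integral_indic // setIT.
have := lebesgue_measure_itv `[x - L, x + L]; rewrite /= lte_fin => ->.
by case: ifP => /=; [move=> _; ring|move/negbT; rewrite -leNgt; lra].
Qed.

(** f(y) - f(x) is approximately the integral of f phi', hence of - g phi, where phi is bounded by 1
    and lives near the segment between the points. The weighted inequality |g| <= l g^2 + 1/l
    replaces Cauchy-Schwarz, [l] being left free for the caller to optimise. *)
Lemma H1_modulus {R : realType} (f : R -> R) : H1 f -> continuous f ->
  exists2 G : R, 0 <= G & forall l x y : R, 0 < l -> `|f x - f y| <= l * G + 2 * `|x - y| / l.
Proof.
move=> [g [_ [[mg Ig] wd]]] cf.
have {}Ig : integr (fun x => g x ^+ 2) by [].
exists (Lint (fun x => g x ^+ 2)); first by apply: Lint_ge0 => x; rewrite sqr_ge0.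
move=> l x y l0; set G := Lint _.
have [D [derD D0 sD D1]] := @exists_bump R.
have cD : continuous (D 0%N) by exact: is_derive_continuous (derD 0%N).
have [T [dT T0 T1 T01]] := exists_step cD sD D0 D1.
have cT : continuous T by exact: is_derive_continuous dT.
apply/ler_addgt0Pr => e e0.
(* The two mollification errors cost 2 ep, and the excess length of the support of [phi] costs 2 ep
   / l; together they make e. *)
pose ep := e / (2 + 2 / l).
have q0 : 0 < 2 + 2 / l by rewrite addr_gt0 // divr_gt0.
have ep0 : 0 < ep by rewrite divr_gt0.
have near_cont z : exists2 d : R, 0 < d & forall t, `|t - z| <= d -> `|f t - f z| <= ep.
  have /cvgr_dist_le /(_ ep ep0) := cf z.
  move=> /nbhs_ballP [d /= d0 h]; exists (d / 2); first by rewrite divr_gt0.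
  move=> t ht; rewrite distrC; apply: h; rewrite /ball /= distrC.
  by apply: (le_lt_trans ht); lra.
have [dx dx0 hx] := near_cont x; have [dy dy0 hy] := near_cont y.
pose d := Num.min (Num.min dx dy) ep.
have d0 : 0 < d by rewrite !lt_min dx0 dy0.
have dlx : d <= dx by rewrite !ge_min lexx.
have dly : d <= dy by rewrite !ge_min lexx orbT.
have dle : d <= ep by rewrite !ge_min lexx orbT.
pose phi t := rescale d y 0 T t - rescale d x 0 T t.
pose L := `|x - y| + d.
have L0 : 0 <= L by rewrite addr_ge0 // ltW.
have outside t : L < `|t - x| -> phi t = 0.
  move=> ht; rewrite /phi /rescale !expr0 !mul1r.
  have ey z : - (z / d) + d^-1 * t = (t - z) / d by ring.
  rewrite !ey; case: (ger0P (t - x)) ht => hs ht; have := ler_norm (x - y); have := ler_norm (y - x); rewrite distrC /L in ht *.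
    by move=> ? ?; rewrite !T1 ?subrr // ltr_pdivlMr // mul1r; lra.
  by move=> ? ?; rewrite !T0 ?subrr // ltr_pdivrMr // mulN1r; lra.
(* The sequence [D] begins with the derivative of the step [T], so order 0 is treated apart and the
   other orders are shifted by one. *)
have Dphi : exists E : nat -> R -> R, [/\ E 0%N = phi,
    forall n (t : R), is_derive t 1 (E n) (E n.+1 t) &
    E 1%N = fun t => rescale d y 1 (D 0%N) t - rescale d x 1 (D 0%N) t].
  exists (fun n t => if n is m.+1 then rescale d y m.+1 (D m) t - rescale d x m.+1 (D m) t else phi t).
  split=> // -[|n] t.
    notypeclasses refine (der_add _ (der_opp _)); first exact: is_derive_rescale.
    exact: is_derive_rescale.
  by notypeclasses refine (der_add _ (der_opp _)); exact: is_derive_rescale.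
have [E [E0 dE E1]] := Dphi.
have tphi : test_fun phi.
  split; first by exists E.
  exists (L + `|x|) => t ht; apply: outside.
  by have := ler_normD (t - x) x; rewrite subrK; lra.
have d1phi : derive1 phi = E 1%N.
  by apply/funext => t; rewrite derive1E -E0 (@derive_val _ _ _ _ _ _ _ (dE 0%N t)).
have := wd phi tphi; rewrite d1phi E1.
have [Iy by_] := mollify_close cf cD d0 sD D0 D1 (fun t h => hy t (le_trans h dly)).
have [Ix bx_] := mollify_close cf cD d0 sD D0 D1 (fun t h => hx t (le_trans h dlx)).
under [X in X = _ -> _]eq_Lint do rewrite mulrBr.
rewrite LintB // => wdE.
have [Ii Li] := indic_itv x L0.
have phi1 t : `|phi t| <= 1.
  rewrite /phi /rescale !expr0 !mul1r ler_norml.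
  have /andP[? ?] := T01 (- (y / d) + d^-1 * t); have /andP[? ?] := T01 (- (x / d) + d^-1 * t).
  by lra.
have bg t : `|g t * phi t| <= l * g t ^+ 2 + l^-1 * \1_[set` `[x - L, x + L]] t.
  have g2 : 0 <= l * g t ^+ 2 by rewrite mulr_ge0 ?sqr_ge0 // ltW.
  have i0 : 0 <= l^-1 * \1_[set` `[x - L, x + L]] t.
    by rewrite mulr_ge0 ?indicE // invr_ge0 ltW.
  have [hL|hL] := leP `|t - x| L; last by rewrite outside // mulr0 normr0 addr_ge0.
  rewrite indicE mem_set /=; last by rewrite in_itv /= -ler_distl.
  rewrite mulr1 normrM.
  apply: (@le_trans _ _ `|g t|); first by rewrite ler_piMr.
  rewrite -(real_normK (num_real (g t))); move: `|g t| (normr_ge0 (g t)) => u u0.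
  have -> : l * u ^+ 2 + l^-1 = ((l * u - 1) ^+ 2 + 2 * (l * u)) / l by field; rewrite gt_eqF.
  rewrite ler_pdivlMr //; have := sqr_ge0 (l * u - 1); nra.
have cphi : continuous phi by rewrite -E0; exact: is_derive_continuous (dE 0%N).
have Ib : integr (fun t => l * g t ^+ 2 + l^-1 * \1_[set` `[x - L, x + L]] t).
  by apply: integrD; exact: integrZ.
have Igp : integr (fun t => g t * phi t).
  apply: integr_le bg Ib; apply: measurable_funM => //; exact: continuous_meas.
have := Lint_norm_le Igp Ib bg.
rewrite LintD; [|exact: integrZ..]; rewrite !LintZ // -/G Li.
have lV : 0 < l^-1 by rewrite invr_gt0.
have eE : e = 2 * ep + l^-1 * (2 * ep) by rewrite /ep; field; rewrite !gt_eqF // ltr_wpDl // mulr_ge0 // ltW.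
move: by_ bx_; rewrite !ler_norml => /andP[b1 b2] /andP[b3 b4] /andP[b5 b6].
have : l^-1 * (2 * L) <= l^-1 * (2 * `|x - y|) + l^-1 * (2 * ep).
  by rewrite -mulrDr ler_wpM2l ?(ltW lV) // /L; lra.
have -> : 2 * `|x - y| / l = l^-1 * (2 * `|x - y|) by rewrite mulrC.
move=> h; rewrite eE; apply/andP; split; lra.
Qed.

Lemma H1_uniformly_continuous {R : realType} (f : R -> R) : H1 f -> continuous f ->
  forall e : R, 0 < e -> exists2 d : R, 0 < d & forall x y, `|x - y| <= d -> `|f x - f y| <= e.
Proof.
move=> hf cf e e0; have [G G0 h] := H1_modulus hf cf.
pose l := e / (2 * (G + 1)).
have G1 : 0 < G + 1 by rewrite ltr_wpDl.
have l0 : 0 < l by rewrite divr_gt0 // mulr_gt0.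
exists (l * e / 4); first by rewrite divr_gt0 // mulr_gt0.
move=> x y xy; apply: (le_trans (h l x y l0)).
have e1 : l * G <= e / 2.
  rewrite /l mulrAC ler_pdivrMr ?mulr_gt0 //; nra.
have e2 : 2 * `|x - y| / l <= e / 2.
  rewrite ler_pdivrMr //; lra.
lra.
Qed.

(** If |f| exceeded e far out, uniform continuity would keep it above e/2 on an interval of fixed
    length 2d, which contributes at least (e/2)^2 2d to a tail of the integral of f^2 that tends to
    0. *)
Lemma H1_vanishes {R : realType} (f : R -> R) : H1 f -> continuous f ->
  forall e : R, 0 < e -> exists2 N : R, 0 <= N & forall x, N < `|x| -> `|f x| <= e.
Proof.
move=> hf cf e e0; have e2 : 0 < e / 2 by rewrite divr_gt0.
have [d d0 hd] := H1_uniformly_continuous hf cf e2.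
have If : integr (fun x => f x ^+ 2) by case: hf => g [[_ I] _].
pose F n := (fun x => f x ^+ 2) \_ [set x : R | n%:R < `|x|].
have mA (n : nat) : measurable [set x : R | n%:R < `|x|].
  have -> : [set x : R | n%:R < `|x|] = ~` [set` `[- n%:R, n%:R]].
    apply/seteqP; split=> x /=; rewrite in_itv /= -ler_norml.
      by move=> h; apply/negP; rewrite -ltNge.
    by move=> /negP; rewrite -ltNge.
  by apply: measurableC; exact: measurable_itv.
have [_ L] : integr (fun _ : R => 0 : R) /\ Lint (F n) @[n --> \oo] --> Lint (fun _ : R => 0 : R).
  apply: (Lint_dct (g := fun x => f x ^+ 2)) => //.
  - move=> n; apply/(measurable_restrictT _ _).1 => //.
    by apply: measurable_funTS; exact: integr_meas.
  - by move=> n x; rewrite /F patchE; case: ifP => _; rewrite ?normr0 ?sqr_ge0 // ger0_norm // sqr_ge0.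
  - move=> x; apply: cvg_near_cst; near=> n; rewrite /F patchE memNset //=.
    by apply/negP; rewrite -leNgt; near: n; apply: nbhs_infty_ger.
have z0 : Lint (fun _ : R => 0 : R) = 0.
  transitivity (Lint (fun x => 0 * f x ^+ 2)); last by rewrite LintZ // mul0r.
  by apply: eq_Lint => x; rewrite mul0r.
rewrite z0 in L.
have c0 : 0 < (e / 2) ^+ 2 * (2 * d) by rewrite !mulr_gt0 // exprn_gt0.
have /cvgr0Pnorm_lt /(_ _ c0) [n _ hn] := L.
exists (n%:R + d); first by rewrite addr_ge0 // ltW.
move=> x hx; rewrite leNgt; apply/negP => fx.
have [Ii Li] := indic_itv x (ltW d0).
have IF : integr (F n).
  apply: (integr_le (g := fun x => f x ^+ 2)) => //.
    apply/(measurable_restrictT _ _).1 => //.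
    by apply: measurable_funTS; exact: integr_meas.
  by move=> z; rewrite /F patchE; case: ifP => _; rewrite ?normr0 ?sqr_ge0 // ger0_norm // sqr_ge0.
have : (e / 2) ^+ 2 * (2 * d) <= Lint (F n).
  rewrite -Li -LintZ //; apply: Lint_le => //; first exact: integrZ.
  move=> t; rewrite indicE; case: (boolP (t \in _)) => ht; last first.
    by rewrite mulr0 /F patchE; case: ifP => // _; exact: sqr_ge0.
  move: ht => /set_mem /=; rewrite in_itv /= -ler_distl mulr1 => ht.
  have tn : n%:R < `|t| by have := ler_normD (x - t) t; rewrite subrK distrC; lra.
  rewrite /F patchE mem_set //.
  have := hd t x ht; have := ler_normD (f x - f t) (f t); rewrite subrK distrC => h1 h2.
  rewrite -[leRHS](real_normK (num_real _)); apply: lerXn2r; rewrite ?nnegrE ?(ltW e2) //; lra.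
move=> h; have := hn n (leqnn n) => /=; have := ler_norm (Lint (F n)); lra.
Unshelve. all: by end_near. Qed.

Lemma vanishing_bounded {R : realType} (f : R -> R) : continuous f ->
  (forall e : R, 0 < e -> exists2 N : R, 0 <= N & forall x, N < `|x| -> `|f x| <= e) ->
  exists2 M : R, 0 <= M & forall x, `|f x| <= M.
Proof.
move=> cf v; have [N N0 h] := v 1 ltr01.
have cn : {within `[- N, N], continuous (fun x => `|f x|)}.
  by apply: continuous_subspaceT; cont.
have [|c _ hc] := EVT_max _ cn; first by lra.
exists (Num.max 1 `|f c|); first by rewrite le_max ler01.
move=> x; rewrite le_max; have [xN|xN] := leP `|x| N.
  by rewrite hc ?orbT // in_itv /= -ler_norml.
by rewrite h.
Qed.

(** * The comparison argument *)

(** After division by the total mass 2/s of the kernel, an exponential of rate t is multiplied by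
    s^2 / (s^2 - t^2): this is how much averaging enlarges the barrier. *)
Lemma Lint_exp_tilt {R : realType} (s t : R) : `|t| < s ->
  integr (fun u => expR (- (s * `|u|)) * expR (t * u)) /\
  Lint (fun u => expR (- (s * `|u|)) * expR (t * u)) = 2 * s / (s ^+ 2 - t ^+ 2).
Proof.
move=> ts; have := ts; rewrite ltr_norml => /andP[t1 t2].
have I : integr (fun u => expR (- (s * `|u|)) * expR (t * u)).
  apply: (integr_le (g := fun u => expR (- ((s - `|t|) * `|u|)))).
  - by apply: continuous_meas; cont.
  - move=> u; rewrite ger0_norm ?mulr_ge0 ?expR_ge0 // -expRD ler_expR.
    by have := ler_norm (t * u); rewrite normrM; lra.
  - by apply: integr_exp; rewrite subr_gt0.
split=> //.
have a0 : 0 < s - t by lra.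
have b0 : 0 < s + t by lra.
pose P1 u := - (s - t)^-1 * expR (- ((s - t) * u)).
pose P2 u := (s + t)^-1 * expR ((s + t) * u).
have -> : 2 * s / (s ^+ 2 - t ^+ 2) = 0 - P1 0 + P2 0 - 0.
  rewrite /P1 /P2 !mulr0 oppr0 expR0 subr_sqr.
  by field; rewrite !gt_eqF.
notypeclasses refine (@Lint_FTC_glue _ _ (fun u => expR (- ((s - t) * u))) (fun u => expR ((s + t) * u)) P1 P2 0 0 0 I _ _ _ _ _ _ _ _).
- by cont.
- by cont.
- by move=> u u0; rewrite ger0_norm // -expRD; congr expR; ring.
- by move=> u u0; rewrite ler0_norm // -expRD; congr expR; ring.
- by move=> u; rewrite /P1; deriv; field; rewrite gt_eqF.
- by move=> u; rewrite /P2; deriv; field; rewrite gt_eqF.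
- apply: (@cvg_pinfty_exp0 _ _ (s - t) (s - t)^-1) => // u _.
  by rewrite /P1 normrM normrN (ger0_norm (expR_ge0 _)) ger0_norm // invr_ge0 ltW.
- apply: (@cvg_ninfty_exp0 _ _ (s + t) (s + t)^-1) => // u _.
  by rewrite /P2 normrM (ger0_norm (expR_ge0 _)) ger0_norm // invr_ge0 ltW.
Qed.

Definition mollify {R : realType} (d : R) (r w : R -> R) (x : R) : R :=
  Lint (fun y => w y * rescale d x 1 r y).

Lemma rescale_shift {R : realType} (d x y : R) (r : R -> R) :
  rescale d x 1 r y = rescale d 0 1 r (y - x).
Proof. by rewrite /rescale; congr (_ * r _); ring. Qed.

Lemma mollifyE {R : realType} (d x : R) (r w : R -> R) : 0 < d -> continuous r -> continuous w ->
  csupp 1 r -> integr (fun z => w (x + d * z) * r z) /\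
  mollify d r w x = Lint (fun z => w (x + d * z) * r z).
Proof.
move=> d0 cr cw sr.
have cF : continuous (fun y => w y * rescale d x 1 r y).
  by have := @continuous_rescale _ d x 1 _ cr => ?; cont.
have I : integr (fun y => w y * rescale d x 1 r y).
  apply: (@integr_csupp _ (d + `|x|)) => // y h.
  by rewrite (@csupp_rescale_total _ d x 1 _ d0 sr _ h) mulr0.
have [J E] := Lint_affine x d0 cF I.
have e : (fun z => d * (w (x + d * z) * rescale d x 1 r (x + d * z))) =
    (fun z => w (x + d * z) * r z).
  apply/funext => z; rewrite /rescale expr1.
  have -> : - (x / d) + d^-1 * (x + d * z) = z by field; rewrite gt_eqF.
  by field; rewrite gt_eqF.
by rewrite -e; split; [exact: integrZ|rewrite LintZ].
Qed.

Lemma continuous_mollify {R : realType} (d : R) (r w : R -> R) : 0 < d -> continuous r ->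
  continuous w -> csupp 1 r -> (forall x, 0 <= r x) -> Lint r = 1 ->
  (forall e : R, 0 < e -> exists2 d : R, 0 < d & forall x y, `|x - y| <= d -> `|w x - w y| <= e) ->
  continuous (mollify d r w).
Proof.
move=> d0 cr cw sr r0 r1 uc x; apply/cvgrPdist_le => e e0.
have [d' d'0 hd] := uc e e0.
apply/nbhs_ballP; exists d' => //= y; rewrite /ball /= => xy.
have [Ix ->] := mollifyE x d0 cr cw sr; have [Iy ->] := mollifyE y d0 cr cw sr.
have Ir := integr_csupp cr sr.
rewrite -LintB // -[e]mulr1 -r1 -LintZ //; apply: Lint_norm_le.
- exact: integrB.
- exact: integrZ.
move=> z; rewrite -mulrBl normrM (ger0_norm (r0 z)) ler_wpM2r // hd //.
by rewrite (_ : _ - _ = x - y) ?ltW //; ring.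
Qed.

(** The kernel is even and translation invariant, so the resolvent passes from the bump to [w],
    where it appears as an average of the mollification around [x]. *)
Lemma Lint_mul_expconv {R : realType} (d s x Mw : R) (r w : R -> R) : 0 < d -> 0 < s ->
  continuous r -> continuous w -> csupp 1 r -> (forall x, `|w x| <= Mw) ->
  [/\ integr (fun y => w y * expconv s (rescale d x 1 r) y),
      integr (fun u => expR (- (s * `|u|)) * mollify d r w (x - u)) &
  Lint (fun y => w y * expconv s (rescale d x 1 r) y) =
  (2 * s)^-1 * Lint (fun u => expR (- (s * `|u|)) * mollify d r w (x - u))].
Proof.
move=> d0 s0 cr cw sr bw.
pose q := rescale d 0 1 r.
have cq : continuous q by exact: continuous_rescale.
have sq : csupp d q by move=> y h; rewrite /q (csupp_rescale (x0 := 0)) // subr0.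
have [Mq Mq0 bq] := csupp_bounded cq sq.
have s2 : 0 < s / 2 by lra.
have bq2 := csupp_exp_bound sq (ltW s2) bq.
have Mw0 : 0 <= Mw by apply: le_trans (bw 0).
pose F := fun z : R * R => w z.1 * (expR (- (s * `|z.2|)) * q (z.1 + z.2 - x)).
have mF : measurable_fun setT F.
  apply: measurable_funM; first by apply: meas_fst; exact: continuous_meas.
  apply: measurable_funM.
    by apply: (meas_snd (f := fun u => expR (- (s * `|u|)))); apply: continuous_meas; cont.
  apply: measurableT_comp; first exact: continuous_meas.
  apply: measurable_funB => //.
  by apply: measurable_funD; [exact: measurable_fst|exact: measurable_snd].
have [I1 _] := Lint_exp_shift x s2.
(* Half of the decay e^(- s |u|) is kept; the other half, with |y - x| <= |y + u - x| + |u|,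
   converts the bound of rate s/2 on the bump into decay in |x - y|. *)
pose C := Mw * (Mq * expR (s / 2 * d)).
have bF y u : `|F (y, u)| <= (C * expR (- (s / 2 * `|x - y|))) * expR (- (s / 2 * `|u|)).
  rewrite /F /= normrM normrM (ger0_norm (expR_ge0 _)) /C -[leRHS]mulrA -[leRHS]mulrA.
  apply: ler_pM; rewrite ?mulr_ge0 ?expR_ge0 //.
  apply: (le_trans (ler_wpM2l (expR_ge0 _) (bq2 (y + u - x)))).
  rewrite mulrCA; apply: ler_wpM2l; first by rewrite mulr_ge0 // expR_ge0.
  rewrite -!expRD ler_expR.
  have := ler_normD (y + u - x) (- u); rewrite (_ : y + u - x - u = y - x); last by ring.
  by rewrite normrN (distrC x y) => h1; nra.
have [J1 J2 E] := Lint_fubini mF (integrZ C I1) (integr_exp s2) bF.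
have E1 : (fun y => Lint (fun u => F (y, u))) = fun y => 2 * s * (w y * expconv s (rescale d x 1 r) y).
  apply/funext => y.
  have cG : continuous (fun z => rescale d x 1 r z * expR (- (s * `|y - z|))).
    by have := @continuous_rescale _ d x 1 _ cr => ?; cont.
  have IG : integr (fun z => rescale d x 1 r z * expR (- (s * `|y - z|))).
    apply: (@integr_csupp _ (d + `|x|)) => // z h.
    by rewrite (@csupp_rescale_total _ d x 1 _ d0 sr _ h) mul0r.
  have [IH EH] := Lint_affine y ltr01 cG IG.
  have e : (fun u => rescale d x 1 r (y + 1 * u) * expR (- (s * `|y - (y + 1 * u)|))) =
     (fun u => expR (- (s * `|u|)) * q (y + u - x)).
    apply/funext => u; rewrite mul1r rescale_shift mulrC -/q.
    by rewrite (_ : y - (y + u) = - u) ?normrN //; ring.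
  rewrite e mul1r in IH EH.
  rewrite /F /= LintZ // -EH /expconv; field.
  by rewrite gt_eqF.
have E2 : (fun u => Lint (fun y => F (y, u))) = fun u => expR (- (s * `|u|)) * mollify d r w (x - u).
  apply/funext => u; rewrite /F /= /mollify -LintZ.
    apply: eq_Lint => y; rewrite rescale_shift -/q (_ : y + u - x = y - (x - u)); last by ring.
    by ring.
  apply: (@integr_csupp _ (d + `|x - u|)).
    by have := @continuous_rescale _ d (x - u) 1 _ cr => ?; cont.
  by move=> y h; rewrite (@csupp_rescale_total _ d (x - u) 1 _ d0 sr _ h) mulr0.
rewrite E1 in J1 E; rewrite E2 in J2 E.
have s3 : 2 * s != 0 by rewrite gt_eqF // mulr_gt0.
have J : integr (fun y => w y * expconv s (rescale d x 1 r) y).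
  have := integrZ (2 * s)^-1 J1; congr integr; apply/funext => y.
  by rewrite mulKf.
split=> //; rewrite -E LintZ //.
by rewrite mulKf.
Qed.

(* Maximum principle against the barrier [C e^(- eta |x|)], applied to a mollification [v]
   of [w]: at a maximum of [v - C e^(- eta |x|)], every term [v - s_j^2 (s_j^2 - D^2)^-1 v]
   of the partial fraction expansion is bounded below by the barrier alone. *)
Lemma exp_decay_upper {R : realType} (mu2 r0 : R) (w f : R -> R) : 0 < mu2 -> 0 <= r0 ->
  continuous w -> continuous f ->
  (forall e : R, 0 < e -> exists2 d : R, 0 < d & forall x y, `|x - y| <= d -> `|w x - w y| <= e) ->
  (forall e : R, 0 < e -> exists2 N : R, 0 <= N & forall x, N < `|x| -> `|w x| <= e) ->
  (forall phi, test_fun phi ->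
     Lint (fun x => w x * fmult (symD mu2) phi x) = Lint (fun x => f x * phi x)) ->
  (forall x, r0 < `|x| -> 0 < w x -> f x <= 0) ->
  exists2 C, 0 <= C & forall x, w x <= C * expR (- (spole mu2 0 / 4 * `|x|)).
Proof.
move=> mu0 r00 cw cf uc vw weak sgnf.
have [M M0 bM] := vanishing_bounded cw vw.
set eta := spole mu2 0 / 4.
have sp0 := spole_gt0 0 mu0.
have eta0 : 0 < eta by rewrite divr_gt0.
(* The barrier dominates [w] up to r0 + 1, not only r0: the bump has radius at most 1, so around a
   contact point its support stays in the region where the sign condition holds. *)
pose C := M * expR (eta * (r0 + 1)).
have C0 : 0 <= C by rewrite mulr_ge0 // expR_ge0.
pose h (x : R) := C * expR (- (eta * `|x|)).
have h0 x : 0 <= h x by rewrite mulr_ge0 // expR_ge0.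
have inner x : `|x| <= r0 + 1 -> w x <= h x.
  move=> xr; apply: (le_trans (ler_norm _)); apply: (le_trans (bM x)).
  rewrite /h /C -mulrA -expRD -[leLHS]mulr1 ler_wpM2l // -[leLHS]expR0 ler_expR -mulrBr.
  by rewrite mulr_ge0 ?(ltW eta0) // subr_ge0.
exists C => // x1; rewrite leNgt; apply/negP => wx1.
pose m := w x1 - h x1.
have m0 : 0 < m by rewrite subr_gt0.
(* m/8 bounds three errors: the mollification, the oscillation of [w] on the support of the bump,
   and [w] at infinity. The excess m over the barrier survives all of them. *)
have m8 : 0 < m / 8 by rewrite divr_gt0.
have [d1 d10 hd1] := uc _ m8.
pose d := Num.min d1 1.
have d0 : 0 < d by rewrite lt_min d10 ltr01.
have dd1 : d <= d1 by rewrite ge_min lexx.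
have dd2 : d <= 1 by rewrite ge_min lexx orbT.
have [D [derD D0 sD D1]] := @exists_bump R.
have cD : continuous (D 0%N) by exact: is_derive_continuous (derD 0%N).
pose v := mollify d (D 0%N) w.
have vw_close x : `|v x - w x| <= m / 8.
  apply: (mollify_close cw cD d0 sD D0 D1 _).2 => y yx.
  by apply: hd1; exact: le_trans dd1.
have cv : continuous v by exact: continuous_mollify.
pose V x := v x - h x.
have cont_inv : continuous V.
  have : continuous h by rewrite (_ : h = fun x => h x) // /h; cont.
  by move=> ?; rewrite (_ : V = fun x => V x) // /V; cont.
have V1 : m * (7 / 8) <= V x1.
  have mE : m = w x1 - h x1 by [].
  by have := vw_close x1; rewrite ler_norml /V => /andP[? _]; lra.
have [N N0 hN] := vw _ m8.
(* A global maximum exists because V is at most m/4 outside a large segment containing [x1], while V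
   at [x1] is at least 7m/8. *)
have [xs Vmax] : exists xs, forall x, V x <= V xs.
  pose L := Num.max N `|x1|.
  have L0 : - L <= L by rewrite ge0_cp // le_max N0.
  have cVL : {within `[- L, L], continuous V} by exact: continuous_subspaceT.
  have [xs _ hxs] := EVT_max L0 cVL.
  have Vx1 : V x1 <= V xs by apply: hxs; rewrite in_itv /= -ler_norml le_max lexx orbT.
  exists xs => x; have [xL|xL] := leP `|x| L; first by apply: hxs; rewrite in_itv /= -ler_norml.
  have xN : N < `|x| by apply: le_lt_trans xL; rewrite le_max lexx.
  have := hN x xN; have := vw_close x; have := h0 x; rewrite !ler_norml => ? /andP[_ ?] /andP[_ ?].
  by rewrite {1}/V; lra.
have Vs : m * (7 / 8) <= V xs by exact: le_trans (Vmax x1).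
have wxs : m * (3 / 4) + h xs <= w xs.
  by have := vw_close xs; rewrite ler_norml => /andP[_ ?]; move: Vs; rewrite /V; lra.
have xsr : r0 + 1 < `|xs|.
  rewrite ltNge; apply/negP => /inner; move: wxs m0; lra.
pose phi := rescale d xs 1 (D 0%N).
pose E n := rescale d xs n.+1 (D n).
have dE n (x : R) : is_derive x 1 (E n) (E n.+1 x) by exact: is_derive_rescale.
have sE : csupp (d + `|xs|) (E 0%N) by exact: csupp_rescale_total.
have cE : continuous (E 0%N) by exact: is_derive_continuous (dE 0%N).
have tphi : test_fun phi by split; [exists E|exists (d + `|xs|)].
have fphi : Lint (fun x => f x * phi x) <= 0.
  have If : integr (fun x => f x * phi x).
    apply: (@integr_csupp _ (d + `|xs|)); first by cont.
    by move=> x hx; rewrite /phi -/(E 0%N) sE // mulr0.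
  rewrite -oppr_ge0 -mulN1r -LintZ //; apply: Lint_ge0 => x; rewrite mulN1r oppr_ge0.
  have [xd|xd] := leP `|x - xs| d; last by rewrite /phi (csupp_rescale (x0 := xs)) // mulr0.
  have ph0 : 0 <= phi x by rewrite /phi /rescale expr1 mulr_ge0 // invr_ge0 ltW.
  rewrite mulr_le0_ge0 // sgnf //.
    by have := ler_normD (xs - x) x; rewrite subrK distrC; lra.
  have := hd1 x xs (le_trans xd dd1); rewrite ler_norml => /andP[? _].
  by have := h0 xs; lra.
have [_ lim] := Lint_fmult_symD mu0 dE sE cw bM.
rewrite (weak phi tphi) in lim.
set a := Num.sqrt mu2.
have a0 : 0 < a by rewrite sqrtr_gt0.
have v_s : Lint (fun x => w x * phi x) = v xs by [].
have Iphi : integr (fun x => w x * phi x).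
  apply: (@integr_csupp _ (d + `|xs|)); first by cont.
  by move=> x hx; rewrite /phi -/(E 0%N) sE // mulr0.
have term j : - (2 * eta ^+ 2 * h xs) * (spole mu2 j ^+ 2)^-1 <=
    v xs - spole mu2 j ^+ 2 * Lint (fun x => w x * expconv (spole mu2 j) phi x).
  set s := spole mu2 j.
  have s0 : 0 < s by exact: spole_gt0.
  have se : 4 * eta <= s.
    rewrite /eta /s [leRHS]spoleE; have j1 : 1 <= j.+1%:R :> R by rewrite ler1n.
    by have := sp0; nra.
  have [_ J ->] := Lint_mul_expconv xs d0 s0 cD cw sD bM.
  (* With the sign of [xs], e^(- t x) lies above e^(- eta |x|) and agrees with it at [xs]: the
     barrier is replaced by a pure exponential, whose average is explicit. *)
  pose t := if 0 <= xs then eta else - eta.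
  have tn : `|t| = eta by rewrite /t; case: ifP => _; rewrite ?normrN ger0_norm // ltW.
  have t2 : t ^+ 2 = eta ^+ 2 by rewrite -(real_normK (num_real t)) tn.
  have txs : t * xs = eta * `|xs|.
    rewrite /t; case: ifPn => [x0|]; first by rewrite ger0_norm.
    by rewrite -ltNge => x0; rewrite ltr0_norm // mulNr mulrN.
  have hshift u : h (xs - u) <= h xs * expR (t * u).
    rewrite /h -mulrA -expRD ler_wpM2l // ler_expR -txs.
    have : t * (xs - u) <= eta * `|xs - u| by rewrite -tn -normrM ler_norm.
    by lra.
  have ts : `|t| < s by rewrite tn; lra.
  have [K EK] := Lint_exp_tilt ts.
  have [K0 EK0] := Lint_exp_shift 0 s0.
  have e0 : (fun y : R => expR (- (s * `|0 - y|))) = (fun y => expR (- (s * `|y|))).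
    by apply/funext => y; rewrite sub0r normrN.
  rewrite e0 in K0 EK0.
  have le : Lint (fun u => expR (- (s * `|u|)) * v (xs - u)) <= V xs * (2 / s) + h xs * (2 * s / (s ^+ 2 - t ^+ 2)).
    rewrite -EK0 -EK -!LintZ // -LintD; [|exact: integrZ..].
    apply: Lint_le => //; first by apply: integrD; exact: integrZ.
    move=> u; rewrite [V xs * _]mulrC (mulrCA (h xs)) -mulrDr ler_wpM2l ?expR_ge0 //.
    have := Vmax (xs - u); have := hshift u; rewrite {1}/V; lra.
  have den : 0 < s ^+ 2 - eta ^+ 2 by nra.
  apply: (@le_trans _ _ (v xs - s ^+ 2 * ((2 * s)^-1 * (V xs * (2 / s) + h xs * (2 * s / (s ^+ 2 - t ^+ 2)))))); last first.
    rewrite lerD2l lerN2; apply: ler_wpM2l; first exact: sqr_ge0.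
    by apply: ler_wpM2l => //; rewrite invr_ge0 mulr_ge0 // ltW.
  rewrite t2 /V; move: (h xs) (h0 xs) (v xs) => H H0 vv.
  have -> : vv - s ^+ 2 * ((2 * s)^-1 * ((vv - H) * (2 / s) + H * (2 * s / (s ^+ 2 - eta ^+ 2)))) =
     - (H * eta ^+ 2) * (s ^+ 2 - eta ^+ 2)^-1.
    by field; rewrite !gt_eqF.
  rewrite !mulNr lerN2.
  have -> : 2 * eta ^+ 2 * H * (s ^+ 2)^-1 = H * eta ^+ 2 * (2 / s ^+ 2) by ring.
  apply: ler_wpM2l; first by rewrite mulr_ge0 // sqr_ge0.
  (* This is s^2 <= 2 (s^2 - eta^2), from 4 eta <= s. *)
  rewrite ler_pdivlMr ?exprn_gt0 // mulrC ler_pdivrMr //; nra.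
have lower k : a^-1 * V xs <= Lint (fun x => w x * Dpart mu2 k phi x).
  have Ij j : integr (fun x => w x * expconv (spole mu2 j) phi x).
    by have [] := Lint_mul_expconv xs d0 (spole_gt0 j mu0) cD cw sD bM.
  have Is j : integr (fun x => w x * phi x - spole mu2 j ^+ 2 * (w x * expconv (spole mu2 j) phi x)).
    by apply: integrB => //; exact: integrZ.
  have [S1 S2] := Lint_sum k Is.
  have -> : (fun x => w x * Dpart mu2 k phi x) = (fun x => a^-1 * (w x * phi x) + 2 / a *
      \sum_(j < k) (w x * phi x - spole mu2 j ^+ 2 * (w x * expconv (spole mu2 j) phi x))).
    apply/funext => x; rewrite /Dpart -/a mulrDr mulrCA (mulrCA (w x) (2 / a)).
    by congr (_ + _ * _); rewrite mulr_sumr; apply: eq_bigr => j _; ring.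
  rewrite LintD; [|exact: integrZ..]; rewrite LintZ // LintZ // S2 v_s.
  have : \sum_(j < k) - (2 * eta ^+ 2 * h xs) * (spole mu2 j ^+ 2)^-1 <=
      \sum_(j < k) Lint (fun x => w x * phi x - spole mu2 j ^+ 2 * (w x * expconv (spole mu2 j) phi x)).
    apply: ler_sum => j _.
    by rewrite LintB //; [rewrite LintZ // v_s|exact: integrZ].
  rewrite -mulr_sumr; set S := \sum_(j < k) Lint _ => hS.
  have hb : - (h xs / 4) <= S.
    apply: le_trans hS; rewrite mulNr lerN2.
    apply: (@le_trans _ _ (2 * eta ^+ 2 * h xs * (2 / spole mu2 0 ^+ 2))).
      apply: ler_wpM2l; last exact: sum_spole_le.
      by apply: mulr_ge0 => //; apply: mulr_ge0 => //; exact: sqr_ge0.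
    rewrite le_eqVlt; apply/orP; left; apply/eqP; rewrite /eta; field.
    by rewrite gt_eqF.
  rewrite [2 / a]mulrC -mulrA -mulrDr ler_wpM2l ?invr_ge0 ?(ltW a0) // /V.
  have := h0 xs; lra.
have Vpos : 0 < a^-1 * V xs by rewrite mulr_gt0 ?invr_gt0 //; apply: lt_le_trans Vs; lra.
have h1 : a^-1 * V xs <= Lint (fun x => f x * phi x).
  rewrite -(cvg_lim _ lim) //; apply: limr_ge; first exact: cvgP lim.
  exact: nearW.
by have := le_trans h1 fphi; rewrite leNgt Vpos.
Qed.

(** * Exponential decay of the solutions *)

Lemma exp_decay {R : realType} (mu2 r0 : R) (w f : R -> R) : 0 < mu2 -> 0 <= r0 ->
  continuous w -> continuous f ->
  (forall e : R, 0 < e -> exists2 d : R, 0 < d & forall x y, `|x - y| <= d -> `|w x - w y| <= e) ->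
  (forall e : R, 0 < e -> exists2 N : R, 0 <= N & forall x, N < `|x| -> `|w x| <= e) ->
  (forall phi, test_fun phi ->
     Lint (fun x => w x * fmult (symD mu2) phi x) = Lint (fun x => f x * phi x)) ->
  (forall x, r0 < `|x| -> f x * w x <= 0) ->
  exists2 C, 0 <= C & forall x, `|w x| <= C * expR (- (spole mu2 0 / 4 * `|x|)).
Proof.
move=> mu0 r00 cw cf uc vw weak sgnf.
have [C1 C10 h1] : exists2 C, 0 <= C & forall x, w x <= C * expR (- (spole mu2 0 / 4 * `|x|)).
  apply: (exp_decay_upper mu0 r00 cw cf uc vw weak) => x xr w0.
  by have := sgnf x xr; rewrite pmulr_lle0.
have [M _ bM] := vanishing_bounded cw vw.
have [C2 C20 h2] : exists2 C, 0 <= C & forall x, - w x <= C * expR (- (spole mu2 0 / 4 * `|x|)).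
  apply: (@exp_decay_upper _ mu2 r0 (fun x => - w x) (fun x => - f x)) => //.
  - by cont.
  - by cont.
  - move=> e e0; have [d d0 hd] := uc e e0; exists d => // x y xy.
    by rewrite -opprD normrN; exact: hd.
  - by move=> e e0; have [N N0 hN] := vw e e0; exists N => // x xN; rewrite normrN hN.
  - move=> phi tphi; have := weak phi tphi.
    have [[D [D0 dDer]] [K sK]] := tphi.
    rewrite -D0 in sK *.
    have [I _] := Lint_fmult_symD mu0 dDer sK cw bM.
    have c0 := is_derive_continuous (dDer 0%N).
    have J : integr (fun x => f x * D 0%N x).
      by apply: (@integr_csupp _ K); [cont|move=> x hx; rewrite sK // mulr0].
    move=> e; transitivity (-1 * Lint (fun x => w x * fmult (symD mu2) (D 0%N) x)).
      by rewrite -LintZ //; apply: eq_Lint => x; ring.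
    by rewrite e -LintZ //; apply: eq_Lint => x; ring.
  - move=> x xr; rewrite oppr_gt0 => w0.
    by have := sgnf x xr; rewrite nmulr_lle0 // oppr_le0.
exists (C1 + C2); first exact: addr_ge0.
move=> x; rewrite ler_norml mulrDl; have := h1 x; have := h2 x.
have e0 := expR_ge0 (- (spole mu2 0 / 4 * `|x|)).
have := mulr_ge0 C10 e0; have := mulr_ge0 C20 e0; move=> *; apply/andP; split; lra.
Qed.

Section solution.
Variables (R : realType) (gamma beta mu eps mu2 c : R) (xi nu : R -> R).
Hypotheses (hg : 0 < gamma < 1) (hb : 1 < beta) (hmu : 0 < mu) (heps : 0 < eps) (hmu2 : 0 < mu2).
Hypothesis hsol : IsSol gamma beta mu eps mu2 c xi nu.

(** The symbols of W and Z are 1 + b1 m and (1 + b2 m) / gamma with m = [symD mu2]. Accordingly [w]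
    collects what the multiplier m acts on and [f] everything else. *)
Let b1 := beta / gamma * Num.sqrt mu.
Let b2 := (beta - 1) / gamma * Num.sqrt mu.
Let w x := gamma^-1 * b2 * nu x - c * b1 * xi x.
Let f x := eps / gamma * (xi x * nu x) + c * xi x - gamma^-1 * nu x.

Lemma IsSol_weak_symD (M : R) : continuous xi -> (forall x, `|xi x| <= M) ->
  (forall x, `|nu x| <= M) -> forall phi, test_fun phi ->
  Lint (fun x => w x * fmult (symD mu2) phi x) = Lint (fun x => f x * phi x).
Proof.
move=> cxi bxi bnu phi tphi.
have [_ [_ [_ [_ [cnu [_ weak]]]]]] := hsol.
have := weak phi tphi.
have [[D [D0 dDer]] [K sK]] := tphi.
rewrite -D0 in sK *.
have c0 := is_derive_continuous (dDer 0%N).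
have [I1 _] := Lint_fmult_symD hmu2 dDer sK cxi bxi.
have [I2 _] := Lint_fmult_symD hmu2 dDer sK cnu bnu.
have J (g : R -> R) : continuous g -> integr (fun x => g x * D 0%N x).
  by move=> cg; apply: (@integr_csupp _ K); [cont|move=> x hx; rewrite sK // mulr0].
have J1 := J _ cxi; have J2 := J _ cnu.
have J3 : integr (fun x => xi x * nu x * D 0%N x) by apply: J; cont.
set S := fmult (symD mu2) (D 0%N) in I1 I2 *.
have EW : Lint (fun x => xi x * fmult (Wsym gamma beta mu mu2) (D 0%N) x) =
    Lint (fun x => xi x * D 0%N x) + b1 * Lint (fun x => xi x * S x).
  rewrite -LintZ // -LintD //; last exact: integrZ.
  by apply: eq_Lint => x; rewrite (fmult_affine_symD hmu2 dDer sK 1 b1 x) -/S; ring.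
have EZ : Lint (fun x => nu x * fmult (Zsym gamma beta mu mu2) (D 0%N) x) =
    gamma^-1 * Lint (fun x => nu x * D 0%N x) + gamma^-1 * b2 * Lint (fun x => nu x * S x).
  rewrite -LintZ // -LintZ // -LintD; [|exact: integrZ..].
  have -> : Zsym gamma beta mu mu2 = fun k => gamma^-1 + gamma^-1 * b2 * symD mu2 k.
    by apply/funext => k; rewrite /Zsym /b2; ring.
  by apply: eq_Lint => x; rewrite (fmult_affine_symD hmu2 dDer sK) -/S; ring.
rewrite EW EZ => e.
transitivity (gamma^-1 * b2 * Lint (fun x => nu x * S x) + (- (c * b1)) * Lint (fun x => xi x * S x)).
  rewrite -LintZ // -LintZ // -LintD; [|exact: integrZ..].
  by apply: eq_Lint => x; rewrite /w; ring.
transitivity (eps / gamma * Lint (fun x => xi x * nu x * D 0%N x) +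
    (c * Lint (fun x => xi x * D 0%N x) + (- gamma^-1) * Lint (fun x => nu x * D 0%N x))).
  by rewrite -e; ring.
rewrite -LintZ // -LintZ // -LintZ // -LintD; [|exact: integrZ..].
rewrite -LintD; [|exact: integrZ|by apply: integrD; exact: integrZ].
by apply: eq_Lint => x; rewrite /f; ring.
Qed.

(** The two bounds on c^2 are exactly the positivity of the linear coefficients [A] of - f and [B]
    of [w], which fixes the opposite signs of [f] and [w] where [nu] is small. *)
Lemma IsSol_exp_decay : c ^+ 2 < (1 - gamma) / gamma ->
  c ^+ 2 < (1 - gamma) / gamma * ((beta - 1) / beta) ->
  exists eta1 N1 : R, [/\ 0 < eta1, 0 < N1 &
    forall x : R, expR (eta1 * `|x|) * `|xi x| <= N1 /\ expR (eta1 * `|x|) * `|nu x| <= N1].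
Proof.
move=> hA hB; have [_ [Hnu [_ [_ [cnu [xiE _]]]]]] := hsol.
have /andP[g0 g1] := hg.
have unu := H1_uniformly_continuous Hnu cnu.
have vnu := H1_vanishes Hnu cnu.
have [M M0 bM] := vanishing_bounded cnu vnu.
pose k := (1 - gamma)^-1; pose e := eps / (2 * gamma).
have k0 : 0 < k by rewrite invr_gt0; lra.
have e0 : 0 < e by rewrite divr_gt0 // mulr_gt0.
have sm0 : 0 < Num.sqrt mu by rewrite sqrtr_gt0.
have b0 : 0 < beta by apply: lt_trans hb.
have b10 : 0 < b1 by rewrite !mulr_gt0 // invr_gt0.
have b20 : 0 < b2 by rewrite !mulr_gt0 ?invr_gt0 // subr_gt0.
have cxi : continuous xi by rewrite (funext xiE); cont.
pose P := k * (`|c| + e * M).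
have P0 : 0 <= P by rewrite mulr_ge0 ?(ltW k0) // addr_ge0 // mulr_ge0 // ltW.
have xi_nu x : `|xi x| <= P * `|nu x|.
  rewrite xiE -/k -/e (_ : c * _ + _ = (c + e * nu x) * nu x); last by ring.
  rewrite !normrM (gtr0_norm k0) mulrA ler_wpM2r // ler_wpM2l ?(ltW k0) //.
  by apply: (le_trans (ler_normD _ _)); rewrite lerD2l normrM gtr0_norm // ler_wpM2l // ltW.
pose B := gamma^-1 * b2 - c ^+ 2 * b1 * k.
pose A := gamma^-1 - c ^+ 2 * k.
have A0 : 0 < A.
  rewrite subr_gt0 /k ltr_pdivrMr; last by lra.
  by rewrite mulrC.
have B0 : 0 < B.
  have -> : B = b1 * k * ((1 - gamma) / gamma * ((beta - 1) / beta) - c ^+ 2).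
    by rewrite /B /b1 /b2 /k; field; rewrite !gt_eqF //; lra.
  by apply: mulr_gt0; [exact: mulr_gt0|rewrite subr_gt0].
pose q := c * b1 * k * e.
have wE x : w x = nu x * (B - q * nu x) by rewrite /w xiE -/k -/e /B /q; ring.
pose T y := c * k * e + eps / gamma * k * (c + e * y).
have fE x : f x = nu x * (- A + T (nu x) * nu x).
  by rewrite /f xiE -/k -/e /A /T; ring.
have cw : continuous w by rewrite (_ : w = fun x => w x) // /w; cont.
have cf : continuous f by rewrite (_ : f = fun x => f x) // /f; cont.
have uw (e' : R) : 0 < e' -> exists2 d : R, 0 < d & forall x y, `|x - y| <= d -> `|w x - w y| <= e'.
  move=> e'0; pose Lw := B + `|q| * (2 * M) + 1.
  have Lw0 : 0 < Lw by rewrite ltr_wpDl // addr_ge0 ?(ltW B0) // !mulr_ge0.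
  have [d d0 hd] := unu (e' / Lw) (divr_gt0 e'0 Lw0); exists d => // x y /hd.
  rewrite ler_pdivlMr // => h; apply: le_trans h.
  rewrite !wE (_ : _ - _ = (nu x - nu y) * (B - q * (nu x + nu y))); last by ring.
  rewrite normrM ler_wpM2l //; apply: (le_trans (ler_normB _ _)).
  rewrite (gtr0_norm B0) normrM /Lw -[leRHS]addrA lerD2l.
  have : `|q| * `|nu x + nu y| <= `|q| * (2 * M).
    rewrite ler_wpM2l // (le_trans (ler_normD _ _)) //; have := bM x; have := bM y; lra.
  by lra.
have vw (e' : R) : 0 < e' -> exists2 N : R, 0 <= N & forall x, N < `|x| -> `|w x| <= e'.
  move=> e'0; pose Lw := B + `|q| * M + 1.
  have Lw0 : 0 < Lw by rewrite ltr_wpDl // addr_ge0 ?(ltW B0) // !mulr_ge0.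
  have [N N0 hN] := vnu (e' / Lw) (divr_gt0 e'0 Lw0); exists N => // x /hN.
  rewrite ler_pdivlMr // => h; apply: le_trans h.
  rewrite wE normrM ler_wpM2l //; apply: (le_trans (ler_normB _ _)).
  rewrite (gtr0_norm B0) normrM /Lw -[leRHS]addrA lerD2l.
  have : `|q| * `|nu x| <= `|q| * M by rewrite ler_wpM2l.
  by lra.
have weak := @IsSol_weak_symD (Num.max M (P * M)) cxi.
have {}weak phi : test_fun phi ->
    Lint (fun x => w x * fmult (symD mu2) phi x) = Lint (fun x => f x * phi x).
  apply: weak => x; rewrite le_max ?bM // orbC.
  by rewrite (le_trans (xi_nu x)) // ler_wpM2l.
pose Q := `|c * k * e| + eps / gamma * k * (`|c| + e * M).
have epsg : 0 < eps / gamma by rewrite divr_gt0.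
have Q0 : 0 <= Q.
  rewrite addr_ge0 // mulr_ge0 //; first by rewrite mulr_ge0 // ltW.
  by rewrite addr_ge0 // mulr_ge0 // ltW.
have TQ x : `|T (nu x)| <= Q.
  apply: (le_trans (ler_normD _ _)); rewrite lerD2l normrM ger0_norm; last by rewrite mulr_ge0 // ltW.
  rewrite ler_wpM2l //; first by rewrite mulr_ge0 // ltW.
  by apply: (le_trans (ler_normD _ _)); rewrite lerD2l normrM gtr0_norm // ler_wpM2l // ltW.
(* The first bound gives |q nu| <= B/2, the second |T(nu) nu| <= A. *)
pose small := Num.min (B / (2 * (`|q| + 1))) (A / (Q + 1)).
have q1 : 0 < `|q| + 1 by rewrite ltr_wpDl.
have Q1 : 0 < Q + 1 by rewrite ltr_wpDl.
have small0 : 0 < small by rewrite lt_min !divr_gt0 // mulr_gt0.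
have [N N0 hN] := vnu small small0.
have far1 x : N < `|x| -> B / 2 <= B - q * nu x.
  move=> /hN; rewrite le_min => /andP[h _]; move: h; rewrite ler_pdivlMr ?mulr_gt0 // => h.
  have := ler_norm (q * nu x); rewrite normrM => h1.
  have := normr_ge0 (nu x); lra.
have far2 x : N < `|x| -> - A + T (nu x) * nu x <= 0.
  move=> /hN; rewrite le_min => /andP[_]; rewrite ler_pdivlMr // => h.
  have := ler_norm (T (nu x) * nu x); rewrite normrM => h1.
  have := ler_wpM2r (normr_ge0 (nu x)) (TQ x); have := normr_ge0 (nu x); lra.
have sgn x : N < `|x| -> f x * w x <= 0.
  move=> xN; rewrite fE wE (_ : _ * _ = nu x ^+ 2 * (B - q * nu x) * (- A + T (nu x) * nu x)); last by ring.
  apply: mulr_ge0_le0; last exact: far2.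
  by rewrite mulr_ge0 ?sqr_ge0 // (le_trans _ (far1 x xN)) // divr_ge0 // ltW.
have [C C0 hC] := exp_decay hmu2 N0 cw cf uw vw weak sgn.
set eta := spole mu2 0 / 4 in hC.
have eta0 : 0 < eta by rewrite divr_gt0 // spole_gt0.
(* Beyond [N], |w| >= (B/2) |nu| transfers the decay of [w] to [nu]; the second summand covers |x|
   <= N, where [nu] is merely bounded. *)
pose C' := 2 * C / B + M * expR (eta * N).
have C'1 : 0 <= 2 * C / B by rewrite divr_ge0 ?(ltW B0) // mulr_ge0.
have C'2 : 0 <= M * expR (eta * N) by rewrite mulr_ge0 // expR_ge0.
have hnu x : expR (eta * `|x|) * `|nu x| <= C'.
  rewrite -ler_pdivlMl ?expR_gt0 // -expRN.
  have [xN|xN] := leP `|x| N.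
    apply: (@le_trans _ _ (expR (- (eta * `|x|)) * (M * expR (eta * N)))).
      rewrite mulrCA -expRD; apply: (le_trans (bM x)); rewrite -[leLHS]mulr1 ler_wpM2l //.
      by rewrite -[leLHS]expR0 ler_expR addrC -mulrBr mulr_ge0 ?(ltW eta0) // subr_ge0.
    by rewrite ler_wpM2l ?expR_ge0 // /C' lerDr.
  apply: (@le_trans _ _ (expR (- (eta * `|x|)) * (2 * C / B))); last first.
    by rewrite ler_wpM2l ?expR_ge0 // /C' lerDl.
  have := hC x; rewrite wE normrM => h.
  rewrite mulrA ler_pdivlMr // mulrCA -ler_pdivrMl // (mulrC 2^-1) -mulrA (mulrC _ C).
  apply: le_trans h; rewrite ler_wpM2l //.
  by apply: (le_trans (far1 x xN)); exact: ler_norm.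
have C'0 : 0 <= C' by exact: addr_ge0.
exists eta, (C' * (1 + P) + 1); split=> //.
  by rewrite ltr_wpDl // mulr_ge0 // addr_ge0.
move=> x; have h := hnu x.
have hP : expR (eta * `|x|) * `|xi x| <= C' * P.
  apply: (@le_trans _ _ (expR (eta * `|x|) * (P * `|nu x|))).
    by rewrite ler_wpM2l ?expR_ge0.
  by rewrite mulrCA (mulrC C') ler_wpM2l.
have := mulr_ge0 C'0 P0; rewrite mulrDr mulr1.
by move=> h1; split; lra.
Qed.

End solution.

Theorem theorem7p2 (R : realType) (gamma beta mu eps : R)
  (hg : 0 < gamma < 1) (hb : 1 < beta) (hmu : 0 < mu) (heps : 0 < eps)
  (xi0 nu0 : R -> R) (hlim : IsLimSol gamma beta mu eps xi0 nu0)
  (M0 : R) (Xi0 Nu0 : R -> R -> R)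
  (h0sol : forall mu2, M0 < mu2 -> IsSol gamma beta mu eps mu2 0 (Xi0 mu2) (Nu0 mu2))
  (h0xi : H1conv Xi0 xi0) (h0nu : H1conv Nu0 nu0) :
  exists M : R, forall mu2 : R, M < mu2 ->
    forall (c0 : R) (Xi Nu : R -> R -> R), 0 < c0 ->
      (forall c, `|c| < c0 -> IsSol gamma beta mu eps mu2 c (Xi c) (Nu c)) ->
      Xi 0 = Xi0 mu2 -> Nu 0 = Nu0 mu2 ->
      smooth_H1 c0 Xi -> smooth_H1 c0 Nu ->
      exists2 c1 : R, 0 < c1 &
        forall c : R, `|c| < c1 -> `|c| < c0 ->
          exists eta1 N1 : R, [/\ 0 < eta1, 0 < N1 &
            forall x : R, expR (eta1 * `|x|) * `|Xi c x| <= N1 /\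
                          expR (eta1 * `|x|) * `|Nu c x| <= N1].
Proof.
(* Positivity of [mu2] makes every pole [spole mu2 j] positive, and the decay rate is a quarter of
   the first. *)
exists 0 => mu2 hmu2 c0 Xi Nu _ hsol _ _ _ _.
have /andP[g0 g1] := hg.
pose a1 := (1 - gamma) / gamma; pose a2 := a1 * ((beta - 1) / beta).
have a10 : 0 < a1 by rewrite divr_gt0 // subr_gt0.
have a20 : 0 < a2 by rewrite mulr_gt0 // divr_gt0 ?subr_gt0 //; lra.
(* The bound 1 gives c^2 <= |c|, so that the thresholds for c^2 can be imposed on |c|. *)
exists (Num.min 1 (Num.min a1 a2)); first by rewrite !lt_min ltr01 a10.
move=> c; rewrite !lt_min => /and3P[c1 ca1 ca2] cc0.
have c2 : c ^+ 2 <= `|c|.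
  by rewrite -(real_normK (num_real c)) expr2 ler_piMl // ltW.
exact: (IsSol_exp_decay hg hb hmu heps hmu2 (hsol c cc0) (le_lt_trans c2 ca1) (le_lt_trans c2 ca2)).
Qed.
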